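(* Let $f:\mathbb R\to\mathbb R$ be $C^2$ and strictly convex with $f(0)=f'(0)=0$, and let $u_0>u_1$ be real numbers. For $\varepsilon>0$ let $\hat u^\varepsilon$ be the unique solution of $$\varepsilon \hat u^\varepsilon_{xx}=(f(\hat u^\varepsilon))_x\ \ (0<x<1),\qquad \hat u^\varepsilon(0)=u_0,\quad \hat u^\varepsilon(1)=u_1 .$$ Then, for every $\varepsilon>0$, $\hat u^\varepsilon$ is the restriction to $[0,1]$ of a whole-line shock: there exists a unique pair $(a,\lambda)\in(0,+\infty)\times\mathbb R$ such that $\hat u^\varepsilon(x)=u\big(\tfrac{x}{\varepsilon}+\lambda;a\big)$ for all $x\in[0,1]$. Furthermore: 1) If $f(u_0)>f(u_1)$, then $u_0>0$ and there is a constant $C>0$, independent of $\varepsilon\in(0,1]$, such that for all $x\in[0,1]$ $$\Big|\hat u^\varepsilon(x)-u\Big(\tfrac{x-1}{\varepsilon}+\phi_{u_0}(u_1);u_0\Big)\Big|\le C\exp\Big(-\tfrac{f'(u_0)}{\varepsilon}\Big).$$ 2) If $f(u_0)<f(u_1)$, then $u_1<0$ and there is a constant $C>0$, independent of $\varepsilon\in(0,1]$, such that for all $x\in[0,1]$ $$\Big|\hat u^\varepsilon(x)-u\Big(\tfrac{x}{\varepsilon}+\phi_{u_1^\dagger}(u_0);u_1^\dagger\Big)\Big|\le C\exp\Big(\tfrac{f'(u_1)}{\varepsilon}\Big).$$ 3) If $f(u_0)=f(u_1)$, then $u_0>0>u_1=u_0^\dagger$ and there is a constant $C>0$, independent of $\varepsilon\in(0,1]$,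 such that for all $x\in[0,1]$ $$\left|\hat u^\varepsilon(x)-u\left(\frac{x-\frac{f'(u_0^\dagger)}{f'(u_0^\dagger)-f'(u_0)}}{\varepsilon}+b;u_0\right)\right|\le\frac{C}{\varepsilon}\exp\left(-\frac{f'(u_0^\dagger)f'(u_0)}{f'(u_0^\dagger)-f'(u_0)}\,\frac1\varepsilon\right),$$ where $$b=\frac{1}{f'(u_0^\dagger)-f'(u_0)}\left(\int_{u_0^\dagger}^{0}\frac{f'(u_0^\dagger)-f'(z)}{f(u_0)-f(z)}\,dz+\int_0^{u_0}\frac{f'(u_0)-f'(z)}{f(u_0)-f(z)}\,dz\right).$$
   Context: For $y\ne0$, $y^\dagger$ denotes the unique real $x\neq y$ with $f(x)=f(y)$ (it exists by strict convexity and $f(0)=f'(0)=0$). For $a>0$, $u(\cdot;a)$ denotes the unique solution on $\mathbb R$ of $u''=(f(u))'$ with $u(-\infty)=a$, $u(+\infty)=a^\dagger$, normalized by $u(0)=0$; equivalently $u'=f(u)-f(a)$, $u(0)=0$. It is a decreasing bijection from $\mathbb R$ onto $(a^\dagger,a)$. For $a>0$ and $y\in(a^\dagger,a)$, $\phi_a(y)$ denotes the unique $x\in\mathbb R$ with $u(x;a)=y$, i.e. $\phi_a(y)=\int_0^y\frac{dz}{f(z)-f(a)}$. For every $\varepsilon>0$ and $u_0,u_1\in\mathbb R$ the boundary value problem in the claim has a unique solution. *)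

(* Defs.v *)
From Stdlib Require Import Reals ClassicalEpsilon.
From Coquelicot Require Import Coquelicot.
Open Scope R_scope.

(* [Derive] is total, so existence of each derivative is required explicitly. *)
Definition C2 (f : R -> R) : Prop :=
  forall x : R,
    ex_derive f x /\ ex_derive (Derive f) x /\ continuous (Derive_n f 2) x.

Definition strictly_convex (f : R -> R) : Prop :=
  forall x y t : R, x <> y -> 0 < t < 1 ->
    f (t * x + (1 - t) * y) < t * f x + (1 - t) * f y.

(* Meaningful for [y <> 0] only; for [y = 0] no such point exists when [f] is
   strictly convex with [f 0 = Derive f 0 = 0]. *)
Definition dagger (f : R -> R) (y : R) : R :=
  epsilon (inhabits 0) (fun x : R => x <> y /\ f x = f y).

Definition is_shock (f : R -> R) (a : R) (u : R -> R) : Prop :=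
  (forall x : R,
     ex_derive u x /\ ex_derive (Derive u) x /\
     Derive_n u 2 x = Derive (fun t : R => f (u t)) x) /\
  is_lim u m_infty a /\
  is_lim u p_infty (dagger f a) /\
  u 0 = 0.

(* [shock f a x] is u(x; a), for [a > 0]. *)
Definition shock (f : R -> R) (a : R) : R -> R :=
  epsilon (inhabits (fun _ : R => 0)) (is_shock f a).

(* The inverse of u(.; a), for [dagger f a < y < a]. *)
Definition phi (f : R -> R) (a y : R) : R :=
  epsilon (inhabits 0) (fun x : R => shock f a x = y).

(* Only the values of [v] on [0,1] matter: derivatives are taken at interior
   points and continuity at the endpoints is relative to [0,1]. *)
Definition is_bvp_solution (f : R -> R) (eps u0 u1 : R) (v : R -> R) : Prop :=
  continuous_on (fun x : R => 0 <= x <= 1) v /\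
  (forall x : R, 0 < x < 1 ->
     ex_derive v x /\ ex_derive (Derive v) x /\
     eps * Derive_n v 2 x = Derive (fun t : R => f (v t)) x) /\
  v 0 = u0 /\ v 1 = u1.

(* Each integrand is 0/0 at the endpoint where [f z = f u0] (in Rocq: 0) and has
   a finite limit there, so these are proper Riemann integrals. *)
Definition shock_shift (f : R -> R) (u0 : R) : R :=
  let d := dagger f u0 in
  1 / (Derive f d - Derive f u0) *
  (RInt (fun z : R => (Derive f d - Derive f z) / (f u0 - f z)) d 0 +
   RInt (fun z : R => (Derive f u0 - Derive f z) / (f u0 - f z)) 0 u0).

(* Main.v *)
(** Integrating once, a solution of the boundary value problem satisfies
    [eps v' = f v - f a] for some [a > 0], so it is a piece of the orbit [u(.; a)],
    and only [c = f a] is to be estimated against [F = f u0].  The travel time from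
    [y0] to [u0] on the level [c] satisfies exactly
    [f'(u0) T = I(c) + ln ((c - f y0) / (c - F))], where
    [I(c) = int_{y0}^{u0} (f'(u0) - f'(z)) / (c - f z) dz] stays bounded as [c -> F]
    and [|I(c) - I(F)| <= K (c - F) T].  This makes [c - F] exponentially small,
    and convexity of [f] bounds the distance between orbits of levels [c] and [F]
    issued from the same point by a multiple of [c - F].  The boundary layer at the
    left end follows by reflecting [z -> f (- z)]; for an interior layer both
    formulas, from the zero of the solution to either end, are combined. *)

Require Import Defs.
From Stdlib Require Import Reals Lra ClassicalEpsilon.
From Coquelicot Require Import Coquelicot.
Open Scope R_scope.

(** The numerator of [I(c)] comes from subtracting [f'(z) / (c - f z)], the derivative of
    [- ln (c - f z)], from [f'(u0) / (c - f z)]: this removes the logarithmic singularity that forms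
    at [u0] as [c] falls to [F], and what remains extends continuously to [u0]. The comparison of
    two levels has to hold for times of order [1 / eps]; a Gronwall bound would lose a factor
    [exp (L / eps)], with [L] a Lipschitz constant of [f], and cancel the gain. Instead the
    difference of the orbits is divided by the speed of one of them, which solves the linearised
    equation, and convexity gives the sign of the remainder. No existence or uniqueness theorem for
    differential equations is used: an orbit is the inverse function of its travel time, a strictly
    monotone primitive. For an interior layer the error in the phase is [c - F] multiplied by a time
    of order [1 / eps], which is the origin of the prefactor [1 / eps]. *)

(** * Convex fluxes: tangents, chords, reflection, monotonicity *)

Record convex_flux (f : R -> R) : Prop := {
  flux_ex : forall x, ex_derive f x;
  flux_ex2 : forall x, ex_derive (Derive f) x;
  flux_incr : forall x y, x < y -> Derive f x < Derive f y;
  flux_at_0 : f 0 = 0;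
  flux_d0 : Derive f 0 = 0 }.

Lemma is_derive_continuity_pt (g : R -> R) (x l : R) :
  is_derive g x l -> continuity_pt g x.
Proof.
  intros H. apply continuity_pt_filterlim. apply (ex_derive_continuous g x).
  now exists l.
Qed.

Lemma constant_on_interval (E : R -> R) (s t : R) :
  (forall x, s <= x <= t -> continuity_pt E x) ->
  (forall x, s < x < t -> is_derive E x 0) ->
  forall x y, s <= x <= t -> s <= y <= t -> E x = E y.
Proof.
  intros Hc Hd x y Hx Hy.
  destruct (MVT_gen E x y (fun _ => 0)) as [c [_ Hc']].
  - intros z [Hz1 Hz2]. apply Hd. revert Hz1 Hz2.
    unfold Rmin, Rmax; destruct (Rle_dec x y); lra.
  - intros z [Hz1 Hz2]. apply Hc. revert Hz1 Hz2.
    unfold Rmin, Rmax; destruct (Rle_dec x y); lra.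
  - lra.
Qed.

Lemma nondecreasing_of_derive (E dE : R -> R) (s t : R) :
  s <= t ->
  (forall x, s <= x <= t -> is_derive E x (dE x)) ->
  (forall x, s <= x <= t -> 0 <= dE x) -> E s <= E t.
Proof.
  intros Hst Hd Hp.
  destruct (MVT_gen E s t dE) as [c [Hc1 Hc2]].
  - intros z Hz. rewrite Rmin_left, Rmax_right in Hz by lra. apply Hd; lra.
  - intros z Hz. rewrite Rmin_left, Rmax_right in Hz by lra.
    apply is_derive_continuity_pt with (dE z), Hd, Hz.
  - rewrite Rmin_left, Rmax_right in Hc1 by lra.
    specialize (Hp c Hc1). nra.
Qed.

Lemma flux_is_derive (f : R -> R) (x : R) :
  convex_flux f -> is_derive f x (Derive f x).
Proof. intros H. apply Derive_correct, (flux_ex f H). Qed.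

Lemma flux_continuous (f : R -> R) (x : R) : convex_flux f -> continuous f x.
Proof. intros H. apply (ex_derive_continuous f x), (flux_ex f H). Qed.

Lemma flux_continuous_derive (f : R -> R) (x : R) :
  convex_flux f -> continuous (Derive f) x.
Proof. intros H. apply (ex_derive_continuous (Derive f) x), (flux_ex2 f H). Qed.

Lemma tangent_le (f : R -> R) (x y : R) :
  convex_flux f -> f x + Derive f x * (y - x) <= f y.
Proof.
  intros H.
  destruct (MVT_gen f x y (Derive f)) as [c [Hc1 Hc2]].
  - intros z _. now apply flux_is_derive.
  - intros z _. now apply continuity_pt_filterlim, flux_continuous.
  - assert (Hm : forall s t, s <= t -> Derive f s <= Derive f t).
    { intros s t [Hs | ->]; [left; now apply (flux_incr f H) | lra]. }
    destruct (Rle_dec x y) as [Hxy | Hxy].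
    + rewrite Rmin_left, Rmax_right in Hc1 by lra.
      assert (Derive f x <= Derive f c) by (apply Hm; lra). nra.
    + rewrite Rmin_right, Rmax_left in Hc1 by lra.
      assert (Derive f c <= Derive f x) by (apply Hm; lra). nra.
Qed.

(** Secant slopes are monotone: combine the tangent at [z], evaluated at both ends, with weights
    [y - z] and [z - x]. The multiplied form also covers [z = y]. *)
Lemma chord_le (f : R -> R) (x z y : R) :
  convex_flux f -> x <= z <= y ->
  (f y - f x) * (y - z) <= (f y - f z) * (y - x).
Proof.
  intros H Hz.
  pose proof (tangent_le f z x H). pose proof (tangent_le f z y H). nra.
Qed.

Lemma Derive_reflect (f : R -> R) (x : R) :
  ex_derive f (- x) -> Derive (fun z => f (- z)) x = - Derive f (- x).
Proof.
  intros H. apply is_derive_unique. auto_derive; [exact H|].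
  change (fun x0 : R => f x0) with f. ring.
Qed.

(** Transfers facts from the positive to the negative half-line, and estimates at the upper end of
    an orbit to its lower end. *)
Lemma convex_flux_reflect (f : R -> R) :
  convex_flux f -> convex_flux (fun z => f (- z)).
Proof.
  intros H.
  assert (HD : forall x, Derive (fun z => f (- z)) x = - Derive f (- x)).
  { intros x. apply Derive_reflect, (flux_ex f H). }
  split.
  - intros x. auto_derive. apply (flux_ex f H).
  - intros x. apply ex_derive_ext with (fun z => - Derive f (- z)).
    + intros t. now rewrite HD.
    + auto_derive. apply (flux_ex2 f H).
  - intros x y Hxy. rewrite !HD.
    assert (Derive f (- y) < Derive f (- x)) by (apply (flux_incr f H); lra).
    lra.
  - rewrite Ropp_0. apply (flux_at_0 f H).
  - rewrite HD, Ropp_0, (flux_d0 f H). ring.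
Qed.

Lemma Derive_flux_pos (f : R -> R) (x : R) :
  convex_flux f -> 0 < x -> 0 < Derive f x.
Proof. intros H Hx. rewrite <- (flux_d0 f H). now apply (flux_incr f H). Qed.

Lemma flux_increasing (f : R -> R) (x y : R) :
  convex_flux f -> 0 <= x -> x < y -> f x < f y.
Proof.
  intros H Hx Hxy.
  (* At [x = 0] the tangent is flat; the midpoint, where the slope is positive, gives strictness. *)
  pose proof (tangent_le f x ((x + y) / 2) H).
  pose proof (tangent_le f ((x + y) / 2) y H).
  assert (0 < Derive f ((x + y) / 2)) by (apply Derive_flux_pos; trivial; lra).
  assert (0 <= Derive f x).
  { destruct Hx as [Hx | <-]; [left; now apply Derive_flux_pos|].
    rewrite (flux_d0 f H); lra. }
  nra.
Qed.

Lemma flux_decreasing (f : R -> R) (x y : R) :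
  convex_flux f -> y <= 0 -> x < y -> f y < f x.
Proof.
  intros H Hy Hxy.
  pose proof (flux_increasing _ (- y) (- x) (convex_flux_reflect f H)) as Hi.
  simpl in Hi. rewrite !Ropp_involutive in Hi. apply Hi; lra.
Qed.

Lemma flux_nonneg (f : R -> R) (x : R) : convex_flux f -> 0 <= f x.
Proof.
  intros H. pose proof (tangent_le f 0 x H) as Ht.
  rewrite (flux_at_0 f H), (flux_d0 f H) in Ht. lra.
Qed.

Lemma flux_pos (f : R -> R) (x : R) : convex_flux f -> 0 < x -> 0 < f x.
Proof.
  intros H Hx. rewrite <- (flux_at_0 f H). apply flux_increasing; trivial; lra.
Qed.

Lemma flux_inj_pos (f : R -> R) (x y : R) :
  convex_flux f -> 0 <= x -> 0 <= y -> f x = f y -> x = y.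
Proof.
  intros H Hx Hy He. destruct (Rtotal_order x y) as [Hl | [Hl | Hl]]; trivial.
  - pose proof (flux_increasing f x y H Hx Hl); lra.
  - pose proof (flux_increasing f y x H Hy Hl); lra.
Qed.

Lemma flux_inj_neg (f : R -> R) (x y : R) :
  convex_flux f -> x <= 0 -> y <= 0 -> f x = f y -> x = y.
Proof.
  intros H Hx Hy He. destruct (Rtotal_order x y) as [Hl | [Hl | Hl]]; trivial.
  - pose proof (flux_decreasing f x y H Hy Hl); lra.
  - pose proof (flux_decreasing f y x H Hx Hl); lra.
Qed.

Lemma flux_onto_pos (f : R -> R) (c : R) :
  convex_flux f -> 0 < c -> exists a, 0 < a /\ f a = c.
Proof.
  intros H Hc.
  assert (H1 : 0 < Derive f 1) by (apply Derive_flux_pos; trivial; lra).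
  (* At [B] the tangent at 1 has risen by exactly [c] above [f 1 > 0]. *)
  set (B := 1 + c / Derive f 1).
  assert (HB : 1 < B) by (unfold B; pose proof (Rdiv_lt_0_compat c _ Hc H1); lra).
  assert (HfB : c < f B).
  { pose proof (tangent_le f 1 B H).
    replace (Derive f 1 * (B - 1)) with c in * by (unfold B; field; lra).
    pose proof (flux_pos f 1 H). lra. }
  destruct (Ranalysis5.IVT_interv (fun x => f x - c) 0 B) as [a [Ha1 Ha2]].
  - intros a _. apply continuity_pt_minus.
    + now apply continuity_pt_filterlim, flux_continuous.
    + apply continuity_pt_const. now intros ? ?.
  - lra.
  - rewrite (flux_at_0 f H). lra.
  - lra.
  - exists a. split; [|lra].
    destruct Ha1 as [[Ha1 | <-] _]; trivial.
    rewrite (flux_at_0 f H) in Ha2. lra.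
Qed.

Lemma flux_onto_neg (f : R -> R) (c : R) :
  convex_flux f -> 0 < c -> exists a, a < 0 /\ f a = c.
Proof.
  intros H Hc.
  destruct (flux_onto_pos _ c (convex_flux_reflect f H) Hc) as [a [Ha1 Ha2]].
  exists (- a). split; [lra | exact Ha2].
Qed.

(** * The conjugate point and sublevel intervals *)

(** [epsilon] is specified only when a witness exists; [x] is that witness. *)
Lemma dagger_spec (f : R -> R) (y x : R) :
  x <> y -> f x = f y -> dagger f y <> y /\ f (dagger f y) = f y.
Proof.
  intros Hx Hf.
  apply (epsilon_spec (inhabits 0) (fun x : R => x <> y /\ f x = f y)).
  now exists x.
Qed.

Lemma dagger_pos (f : R -> R) (a : R) :
  convex_flux f -> 0 < a -> dagger f a < 0 /\ f (dagger f a) = f a.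
Proof.
  intros H Ha.
  destruct (flux_onto_neg f (f a) H (flux_pos f a H Ha)) as [d [Hd1 Hd2]].
  destruct (dagger_spec f a d) as [H1 H2]; [lra | trivial |].
  split; trivial.
  destruct (Rlt_le_dec (dagger f a) 0) as [Hl | Hl]; trivial.
  exfalso; apply H1. apply (flux_inj_pos f); trivial; lra.
Qed.

Lemma dagger_neg (f : R -> R) (a : R) :
  convex_flux f -> a < 0 -> 0 < dagger f a /\ f (dagger f a) = f a.
Proof.
  intros H Ha.
  assert (Hfa : 0 < f a).
  { rewrite <- (flux_at_0 f H). apply flux_decreasing; trivial; lra. }
  destruct (flux_onto_pos f (f a) H Hfa) as [d [Hd1 Hd2]].
  destruct (dagger_spec f a d) as [H1 H2]; [lra | trivial |].
  split; trivial.
  destruct (Rlt_le_dec 0 (dagger f a)) as [Hl | Hl]; trivial.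
  exfalso; apply H1. apply (flux_inj_neg f); trivial; lra.
Qed.

Lemma dagger_unique (f : R -> R) (a d : R) :
  convex_flux f -> 0 < a -> d < 0 -> f d = f a -> dagger f a = d.
Proof.
  intros H Ha Hd He. destruct (dagger_pos f a H Ha).
  apply (flux_inj_neg f); trivial; lra.
Qed.

(** Orbit arguments control the flux value, while domains of integration are intervals of positions;
    this equivalence passes between the two. *)
Lemma flux_lt_level (f : R -> R) (a z : R) :
  convex_flux f -> 0 < a -> (f z < f a <-> dagger f a < z < a).
Proof.
  intros H Ha. destruct (dagger_pos f a H Ha) as [Hd1 Hd2].
  split; intros Hz.
  - split.
    + destruct (Rlt_le_dec (dagger f a) z) as [Hl | [Hl | Hl]]; trivial.
      * pose proof (flux_decreasing f z (dagger f a) H); lra.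
      * subst z; lra.
    + destruct (Rlt_le_dec z a) as [Hl | [Hl | Hl]]; trivial.
      * pose proof (flux_increasing f a z H); lra.
      * subst z; lra.
  - destruct (Rle_dec 0 z).
    + apply flux_increasing; trivial; lra.
    + rewrite <- Hd2. apply flux_decreasing; trivial; lra.
Qed.

(** * From strict convexity to a strictly increasing derivative *)

(** If the inequality failed, [f (x + t (y - x)) - t (f y - f x)] would have a positive derivative
    [l] at [t = 0], whereas convexity puts its values at small [t > 0] below its value at 0. *)
Lemma convex_tangent (f : R -> R) (x y : R) :
  strictly_convex f -> ex_derive f x -> f x + Derive f x * (y - x) <= f y.
Proof.
  intros Hc Hex.
  destruct (Rle_lt_dec (f x + Derive f x * (y - x)) (f y)) as [Hl | Hl]; trivial.
  exfalso.
  destruct (Req_dec x y) as [-> | Hxy]; [lra|].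
  set (l := Derive f x * (y - x) - (f y - f x)).
  assert (Hd : is_derive (fun t => f (x + t * (y - x)) - t * (f y - f x)) 0 l).
  { auto_derive.
    - now rewrite Rmult_0_l, Rplus_0_r.
    - rewrite Rmult_0_l, Rplus_0_r. unfold l. change (fun x0 : R => f x0) with f. ring. }
  apply is_derive_Reals in Hd.
  assert (Hl0 : 0 < l) by (unfold l; lra).
  destruct (Hd (l / 2)) as [delta Hdelta]; [lra|].
  set (h := Rmin (delta / 2) (1 / 2)).
  assert (Hh : 0 < h /\ h < delta /\ h < 1).
  { pose proof (cond_pos delta). unfold h, Rmin.
    destruct (Rle_dec (delta / 2) (1 / 2)); lra. }
  specialize (Hdelta h). rewrite Rplus_0_l, !Rmult_0_l, Rplus_0_r in Hdelta.
  assert (Hs := Hdelta ltac:(lra) ltac:(rewrite Rabs_pos_eq; lra)).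
  apply Rabs_def2 in Hs.
  specialize (Hc y x h ltac:(congruence) ltac:(lra)).
  replace (h * y + (1 - h) * x) with (x + h * (y - x)) in Hc by ring.
  set (A := f (x + h * (y - x)) - h * (f y - f x) - (f x - 0)) in Hs.
  assert (HA : A < 0) by (unfold A; nra).
  assert (A / h < 0).
  { apply Rmult_lt_reg_r with h; [lra|]. unfold Rdiv.
    rewrite Rmult_assoc, Rinv_l; lra. }
  lra.
Qed.

(** The tangents at [x] and [y] pass below [f m] at the midpoint [m], and [f m] is strictly below
    the chord; hence the chord slope lies strictly between [f'(x)] and [f'(y)]. *)
Lemma convex_flux_intro (f : R -> R) :
  C2 f -> strictly_convex f -> f 0 = 0 -> Derive f 0 = 0 -> convex_flux f.
Proof.
  intros H2 Hc H0 Hd0.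
  split; trivial; try (intros x; apply H2).
  intros x y Hxy.
  set (m := / 2 * x + (1 - / 2) * y).
  pose proof (Hc x y (/ 2) ltac:(lra) ltac:(lra)) as Hm. fold m in Hm.
  pose proof (convex_tangent f x m Hc (proj1 (H2 x))).
  pose proof (convex_tangent f y m Hc (proj1 (H2 y))).
  replace (m - x) with ((y - x) / 2) in * by (unfold m; lra).
  replace (m - y) with (- ((y - x) / 2)) in * by (unfold m; lra).
  nra.
Qed.

(** * The equation [v' = kappa (f v - c)]: persistence of the sign *)

Lemma continuous_flux_comp (f v : R -> R) (x : R) :
  convex_flux f -> continuous v x -> continuous (fun t => f (v t)) x.
Proof.
  intros H Hv. apply (continuous_comp v f); trivial. now apply flux_continuous.
Qed.

Lemma is_derive_flux_comp (f v : R -> R) (x l : R) :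
  convex_flux f -> is_derive v x l ->
  is_derive (fun t : R => f (v t)) x (l * Derive f (v x)).
Proof.
  intros H Hv. apply (is_derive_comp f v); trivial. now apply flux_is_derive.
Qed.

Lemma is_derive_sub_mul_exp (w I : R -> R) (c y lw lI : R) :
  is_derive w y lw -> is_derive I y lI ->
  is_derive (fun y => (c - w y) * exp (- I y)) y
    (- lw * exp (- I y) + (c - w y) * (- lI * exp (- I y))).
Proof.
  intros Hw HI. auto_derive.
  - split; [now exists lw | split; [now exists lI | trivial]].
  - change (fun x : R => w x) with w. change (fun x : R => I x) with I.
    rewrite (is_derive_unique w y _ Hw), (is_derive_unique I y _ HI). ring.
Qed.

(* The integrating factor [exp (- H)] makes [c - f v] constant, so its sign
   propagates. *)
Lemma flux_below_preserved (f v : R -> R) (kappa c s t x0 : R) :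
  convex_flux f -> (forall x, continuous v x) ->
  (forall x, s < x < t -> is_derive v x (kappa * (f (v x) - c))) ->
  s <= x0 <= t -> f (v x0) < c ->
  forall x, s <= x <= t -> f (v x) < c.
Proof.
  intros H Hv Hd Hx0 Hlt x Hx.
  set (h := fun z => kappa * Derive f (v z)).
  assert (Hh : forall z, continuous h z).
  { intros z. apply (continuous_mult (fun _ => kappa) (fun z => Derive f (v z))).
    - apply continuous_const.
    - apply (continuous_comp v (Derive f)); trivial.
      now apply flux_continuous_derive. }
  set (I := fun y => RInt h s y).
  assert (HI : forall y, is_derive I y (h y)).
  { intros y. apply (is_derive_RInt h I s y).
    - apply filter_forall. intros z. apply (RInt_correct h).
      apply (ex_RInt_continuous h). intros; apply Hh.
    - apply Hh. }
  set (E := fun y => (c - f (v y)) * exp (- I y)).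
  assert (HE : E x = E x0).
  { apply constant_on_interval with s t; trivial.
    - intros y _. apply continuity_pt_filterlim.
      apply (continuous_mult (fun y => c - f (v y)) (fun y => exp (- I y))).
      + apply (continuous_minus (fun _ => c) (fun y => f (v y))).
        * apply continuous_const.
        * now apply continuous_flux_comp.
      + apply (continuous_comp (fun y => - I y) exp).
        * apply (continuous_opp I), (ex_derive_continuous I). now exists (h y).
        * apply (ex_derive_continuous exp). auto_derive; trivial.
    - intros y Hy.
      pose proof (is_derive_flux_comp f v y _ H (Hd y Hy)) as H1.
      replace 0 with (- (kappa * (f (v y) - c) * Derive f (v y)) * exp (- I y)
        + (c - f (v y)) * (- h y * exp (- I y))) by (unfold h; ring).
      exact (is_derive_sub_mul_exp (fun y => f (v y)) I c y _ _ H1 (HI y)). }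
  unfold E in HE.
  pose proof (exp_pos (- I x)). pose proof (exp_pos (- I x0)).
  assert (0 < (c - f (v x0)) * exp (- I x0)) by (apply Rmult_lt_0_compat; lra).
  destruct (Rlt_le_dec (f (v x)) c); trivial. exfalso. nra.
Qed.

(** * The travel time on a level and its range *)

(** The sign is opposite to that in the integral for [phi], which makes the integrand positive: this
    is minus the inverse of u(.; a). *)
Definition travel_time (f : R -> R) (a y : R) : R :=
  RInt (fun z => / (f a - f z)) 0 y.

Lemma continuous_inv_gap (f : R -> R) (c z : R) :
  convex_flux f -> f z < c -> continuous (fun z => / (c - f z)) z.
Proof.
  intros H Hz. apply (ex_derive_continuous (fun z => / (c - f z))).
  auto_derive. split; [apply (flux_ex f H) | split; trivial; lra].
Qed.

Lemma is_derive_travel_time (f : R -> R) (a y : R) :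
  convex_flux f -> 0 < a -> dagger f a < y < a ->
  is_derive (travel_time f a) y (/ (f a - f y)).
Proof.
  intros H Ha Hy. destruct (dagger_pos f a H Ha) as [Hd _].
  assert (Hc : forall z, dagger f a < z < a ->
                 continuous (fun z => / (f a - f z)) z).
  { intros z Hz. apply continuous_inv_gap; trivial.
    now apply (flux_lt_level f a z H Ha). }
  apply (is_derive_RInt (fun z => / (f a - f z)) (travel_time f a) 0 y).
  - apply (locally_interval _ y (dagger f a) a); [apply Hy | apply Hy |].
    intros z Hz1 Hz2. apply (RInt_correct (fun z => / (f a - f z))).
    apply (ex_RInt_continuous (fun z => / (f a - f z))).
    intros w [Hw1 Hw2]. apply Hc. simpl in Hz1, Hz2. revert Hw1 Hw2.
    unfold Rmin, Rmax; destruct (Rle_dec 0 z); lra.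
  - now apply Hc.
Qed.

Lemma travel_time_0 (f : R -> R) (a : R) : travel_time f a 0 = 0.
Proof. exact (RInt_point 0 (fun z => / (f a - f z))). Qed.

(** The bound on [c - y1] is kept because differentiating the inverse function requires the
    intermediate point to tend to [y1]. *)
Lemma travel_time_MVT (f : R -> R) (a y1 y2 : R) :
  convex_flux f -> 0 < a -> dagger f a < y1 < a -> dagger f a < y2 < a ->
  exists c, Rabs (c - y1) <= Rabs (y2 - y1) /\ dagger f a < c < a /\
    travel_time f a y2 - travel_time f a y1 = / (f a - f c) * (y2 - y1).
Proof.
  intros H Ha H1 H2.
  destruct (MVT_gen (travel_time f a) y1 y2 (fun c => / (f a - f c)))
    as [c [Hc1 Hc2]].
  - intros z [Hz1 Hz2]. apply is_derive_travel_time; trivial. revert Hz1 Hz2.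
    unfold Rmin, Rmax; destruct (Rle_dec y1 y2); lra.
  - intros z [Hz1 Hz2].
    apply is_derive_continuity_pt with (/ (f a - f z)), is_derive_travel_time;
      trivial. revert Hz1 Hz2.
    unfold Rmin, Rmax; destruct (Rle_dec y1 y2); lra.
  - exists c. destruct Hc1 as [Hc1 Hc3]. revert Hc1 Hc3.
    unfold Rmin, Rmax, Rabs; destruct (Rle_dec y1 y2);
      destruct (Rcase_abs (c - y1)); destruct (Rcase_abs (y2 - y1));
      intros; (split; [lra | split; [lra | trivial]]).
Qed.

Lemma travel_time_increasing (f : R -> R) (a y1 y2 : R) :
  convex_flux f -> 0 < a -> dagger f a < y1 -> y1 < y2 -> y2 < a ->
  travel_time f a y1 < travel_time f a y2.
Proof.
  intros H Ha H1 H2 H3.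
  destruct (travel_time_MVT f a y1 y2 H Ha) as [c [_ [Hc He]]]; try lra.
  apply (flux_lt_level f a c H Ha) in Hc.
  assert (0 < / (f a - f c) * (y2 - y1)).
  { apply Rmult_lt_0_compat; [apply Rinv_0_lt_compat|]; lra. }
  lra.
Qed.

Lemma travel_time_inj (f : R -> R) (a y1 y2 : R) :
  convex_flux f -> 0 < a -> dagger f a < y1 < a -> dagger f a < y2 < a ->
  travel_time f a y1 = travel_time f a y2 -> y1 = y2.
Proof.
  intros H Ha H1 H2 He. destruct (Rtotal_order y1 y2) as [Hl | [Hl | Hl]]; trivial.
  - pose proof (travel_time_increasing f a y1 y2 H Ha); lra.
  - pose proof (travel_time_increasing f a y2 y1 H Ha); lra.
Qed.

(* [f a - f y <= f'(a) (a - y)] makes the travel time diverge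
   logarithmically at [a]. *)
Lemma travel_time_unbounded_above (f : R -> R) (a M : R) :
  convex_flux f -> 0 < a -> 0 < M ->
  exists y, 0 < y < a /\ M <= travel_time f a y.
Proof.
  intros H Ha HM. destruct (dagger_pos f a H Ha) as [Hd _].
  pose proof (Derive_flux_pos f a H Ha) as Hp. set (p := Derive f a) in *.
  assert (He : 0 < exp (- (p * M)) < 1).
  { split; [apply exp_pos|]. rewrite <- exp_0. apply exp_increasing. nra. }
  (* Chosen so that [ln (a - y) = ln a - p * M]; the monotone quantity [p T + ln (a - y)] then
     yields [T >= M]. *)
  set (y := a - a * exp (- (p * M))).
  assert (Hy : 0 < y < a) by (unfold y; nra).
  exists y. split; trivial.
  pose proof (nondecreasing_of_derive
    (fun y => p * travel_time f a y + ln (a - y))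
    (fun y => p * / (f a - f y) - / (a - y)) 0 y) as Hm.
  assert (HE : p * travel_time f a 0 + ln (a - 0)
               <= p * travel_time f a y + ln (a - y)).
  { apply Hm.
    - lra.
    - intros z Hz.
      pose proof (is_derive_travel_time f a z H Ha ltac:(lra)) as H1.
      set (T := travel_time f a) in *. clearbody T.
      auto_derive.
      + split; [eexists; exact H1 | split; [lra | trivial]].
      + change (fun x : R => T x) with T.
        rewrite (is_derive_unique _ z _ H1). unfold Rdiv, Rminus. ring.
    - intros z Hz.
      assert (Hg : f z < f a) by (apply (flux_lt_level f a z H Ha); lra).
      pose proof (tangent_le f a z H) as Ht. fold p in Ht.
      assert (/ (p * (a - z)) <= / (f a - f z)).
      { apply Rinv_le_contravar; lra. }
      rewrite Rinv_mult in H0.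
      apply (Rmult_le_compat_l p) in H0; [|lra].
      rewrite <- Rmult_assoc, Rinv_r, Rmult_1_l in H0 by lra. lra. }
  replace (a - y) with (a * exp (- (p * M))) in HE by (unfold y; ring).
  rewrite travel_time_0, ln_mult, ln_exp, Rminus_0_r in HE; [|lra|lra].
  apply Rmult_le_reg_l with p; lra.
Qed.

Lemma RInt_reflect (h : R -> R) (a b : R) :
  ex_RInt h (- a) (- b) -> RInt (fun y => h (- y)) a b = - RInt h (- a) (- b).
Proof.
  intros Hex. apply is_RInt_unique.
  pose proof (is_RInt_opp _ _ _ _ (is_RInt_comp_opp _ _ _ _
                (RInt_correct h _ _ Hex))) as Ho.
  revert Ho. apply is_RInt_ext.
  intros x _. apply opp_opp.
Qed.

(** [- dagger f a] is the positive point where the reflected flux has the value [f a], so both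
    travel times refer to the same level. *)
Lemma travel_time_reflect (f : R -> R) (a y : R) :
  convex_flux f -> 0 < a -> dagger f a < y < a ->
  travel_time (fun z => f (- z)) (- dagger f a) (- y) = - travel_time f a y.
Proof.
  intros H Ha Hy. destruct (dagger_pos f a H Ha) as [Hd He].
  unfold travel_time. rewrite Ropp_involutive, He.
  set (h := fun z => / (f a - f z)).
  assert (Hex : ex_RInt h (- 0) (- - y)).
  { apply (ex_RInt_continuous h). intros w [Hw1 Hw2].
    rewrite Ropp_0, Ropp_involutive in *. apply continuous_inv_gap; trivial.
    apply (flux_lt_level f a w H Ha). revert Hw1 Hw2.
    unfold Rmin, Rmax; destruct (Rle_dec 0 y); lra. }
  pose proof (RInt_reflect h 0 (- y) Hex) as Hr.
  now rewrite Ropp_0, Ropp_involutive in Hr.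
Qed.

Lemma travel_time_unbounded_below (f : R -> R) (a M : R) :
  convex_flux f -> 0 < a -> 0 < M ->
  exists y, dagger f a < y < 0 /\ travel_time f a y <= - M.
Proof.
  intros H Ha HM. destruct (dagger_pos f a H Ha) as [Hd He].
  destruct (travel_time_unbounded_above _ (- dagger f a) M
              (convex_flux_reflect f H)) as [y [Hy1 Hy2]]; try lra.
  exists (- y). split; [lra|].
  pose proof (travel_time_reflect f a (- y) H Ha ltac:(lra)) as Hr.
  rewrite Ropp_involutive in Hr. lra.
Qed.

Lemma travel_time_onto (f : R -> R) (a x : R) :
  convex_flux f -> 0 < a -> exists y, dagger f a < y < a /\ travel_time f a y = x.
Proof.
  intros H Ha.
  destruct (travel_time_unbounded_above f a (Rabs x + 1) H Ha) as [y2 [Hy2 Ht2]].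
  { pose proof (Rabs_pos x); lra. }
  destruct (travel_time_unbounded_below f a (Rabs x + 1) H Ha) as [y1 [Hy1 Ht1]].
  { pose proof (Rabs_pos x); lra. }
  pose proof (Rle_abs x). pose proof (Rle_abs (- x)). rewrite Rabs_Ropp in *.
  destruct (Ranalysis5.IVT_interv (fun y => travel_time f a y - x) y1 y2)
    as [y [Hy Hz]]; try lra.
  - intros z Hz. apply continuity_pt_minus.
    + apply is_derive_continuity_pt with (/ (f a - f z)).
      apply is_derive_travel_time; trivial; lra.
    + apply continuity_pt_const. now intros ? ?.
  - exists y. split; lra.
Qed.

(** * Existence of the whole-line shock *)

(** [U] inverts minus the travel time. By the mean value theorem its difference quotient equals
    [f c - f a] for some [c] near [U x], so only the continuity of [f] at [U x] is left to use. *)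
Lemma exists_profile (f : R -> R) (a : R) :
  convex_flux f -> 0 < a ->
  exists U : R -> R,
    (forall x, dagger f a < U x < a /\ travel_time f a (U x) = - x) /\
    forall x, is_derive U x (f (U x) - f a).
Proof.
  intros H Ha.
  set (P := fun x y => dagger f a < y < a /\ travel_time f a y = - x).
  set (U := fun x => epsilon (inhabits 0) (P x)).
  assert (HU : forall x, P x (U x)).
  { intros x. apply epsilon_spec. apply (travel_time_onto f a (- x) H Ha). }
  exists U. split; [exact HU|].
  intros x. apply is_derive_Reals. intros e He.
  pose proof (flux_continuous f (U x) H) as Hc.
  apply (proj1 (filterlim_locally f (f (U x)))) with (eps := mkposreal e He) in Hc.
  destruct Hc as [r Hr].
  pose proof (flux_pos f a H Ha) as HF. pose proof (cond_pos r) as Hr0.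
  (* Since [0 <= f c], the speed is at most [f a]; a step shorter than [r / f a] keeps [c] within
     [r] of [U x]. *)
  assert (Hq : 0 < r / f a) by (now apply Rdiv_lt_0_compat).
  exists (mkposreal _ Hq). intros h Hh0 Hh. simpl in Hh.
  destruct (HU x) as [Hx1 Hx2]. destruct (HU (x + h)) as [Hy1 Hy2].
  destruct (travel_time_MVT f a (U x) (U (x + h)) H Ha Hx1 Hy1)
    as [c [Hc1 [Hc2 Hc3]]].
  apply (flux_lt_level f a c H Ha) in Hc2.
  pose proof (flux_nonneg f c H) as Hc4.
  assert (Hdiff : U (x + h) - U x = - h * (f a - f c)).
  { rewrite Hx2, Hy2 in Hc3.
    replace (- h) with (/ (f a - f c) * (U (x + h) - U x)) by lra.
    field. lra. }
  replace ((U (x + h) - U x) / h) with (f c - f a)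
    by (rewrite Hdiff; field; trivial).
  replace (f c - f a - (f (U x) - f a)) with (f c - f (U x)) by ring.
  apply (Hr c).
  unfold ball; simpl; unfold AbsRing_ball, abs, minus, plus, opp; simpl.
  apply Rle_lt_trans with (1 := Hc1).
  rewrite Hdiff, Rabs_mult, Rabs_Ropp, (Rabs_pos_eq (f a - f c)) by lra.
  apply Rle_lt_trans with (Rabs h * f a).
  - apply Rmult_le_compat_l; [apply Rabs_pos | lra].
  - apply Rmult_lt_reg_r with (/ f a); [now apply Rinv_0_lt_compat|].
    rewrite Rmult_assoc, Rinv_r, Rmult_1_r by lra. exact Hh.
Qed.

Lemma exists_shock (f : R -> R) (a : R) :
  convex_flux f -> 0 < a -> exists u, is_shock f a u.
Proof.
  intros H Ha. destruct (dagger_pos f a H Ha) as [Hd _].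
  destruct (exists_profile f a H Ha) as [U [HU HD]].
  exists U.
  assert (HDe : forall x, f (U x) - f a = Derive U x).
  { intros x. symmetry. apply is_derive_unique, HD. }
  assert (Hlt : forall x y, dagger f a < y < a -> x < - travel_time f a y -> y < U x).
  { intros x y Hy Hx. destruct (HU x) as [H1 H2].
    destruct (Rlt_le_dec y (U x)) as [Hl | [Hl | Hl]]; trivial.
    - pose proof (travel_time_increasing f a (U x) y H Ha); lra.
    - rewrite Hl in H2; lra. }
  assert (Hgt : forall x y, dagger f a < y < a -> - travel_time f a y < x -> U x < y).
  { intros x y Hy Hx. destruct (HU x) as [H1 H2].
    destruct (Rlt_le_dec (U x) y) as [Hl | [Hl | Hl]]; trivial.
    - pose proof (travel_time_increasing f a y (U x) H Ha); lra.
    - rewrite <- Hl in H2; lra. }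
  split; [|split; [|split]].
  - intros x.
    pose proof (is_derive_flux_comp f U x _ H (HD x)) as Hfu.
    assert (Hsec : is_derive (Derive U) x ((f (U x) - f a) * Derive f (U x))).
    { apply is_derive_ext with (1 := HDe).
      replace ((f (U x) - f a) * Derive f (U x))
        with ((f (U x) - f a) * Derive f (U x) - 0) by ring.
      apply (is_derive_minus (fun t => f (U t)) (fun _ => f a)); trivial.
      apply (is_derive_const (f a)). }
    split; [eexists; apply HD|]. split; [eexists; exact Hsec|].
    rewrite (is_derive_unique _ x _ Hfu).
    exact (is_derive_unique _ x _ Hsec).
  - apply is_lim_spec. intros e. pose proof (cond_pos e).
    (* Truncation at 0 keeps [y] in the range of the profile when [e] is large. *)
    set (y := Rmax (a - e / 2) 0).
    assert (Hy : dagger f a < y < a /\ a - e < y).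
    { unfold y, Rmax; destruct (Rle_dec (a - e / 2) 0); lra. }
    exists (- travel_time f a y). intros x Hx.
    pose proof (Hlt x y (proj1 Hy) Hx). destruct (HU x) as [HUx _].
    apply Rabs_def1; lra.
  - apply is_lim_spec. intros e. pose proof (cond_pos e).
    set (y := Rmin (dagger f a + e / 2) 0).
    assert (Hy : dagger f a < y < a /\ y < dagger f a + e).
    { unfold y, Rmin; destruct (Rle_dec (dagger f a + e / 2) 0); lra. }
    exists (- travel_time f a y). intros x Hx.
    pose proof (Hgt x y (proj1 Hy) Hx). destruct (HU x) as [HUx _].
    apply Rabs_def1; lra.
  - destruct (HU 0) as [H1 H2].
    apply (travel_time_inj f a); trivial; [lra|].
    rewrite H2, travel_time_0. ring.
Qed.

(** * First integral and basic properties of the shock *)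

(** [u' - f u] is constant, but [is_shock] does not state that [u'] tends to 0. The constant is
    identified by the mean value theorem on a unit interval far to the left, where the increment of
    [u] is small and [f u] is close to [f a]. *)
Lemma is_shock_first_integral (f u : R -> R) (a : R) :
  convex_flux f -> is_shock f a u -> forall x, is_derive u x (f (u x) - f a).
Proof.
  intros H [Hu [Hm _]].
  assert (Hd1 : forall x, is_derive u x (Derive u x)).
  { intros x. apply Derive_correct, Hu. }
  set (E := fun x => Derive u x - f (u x)).
  assert (HE : forall x, is_derive E x 0).
  { intros x. destruct (Hu x) as [_ [H2 H3]].
    apply Derive_correct in H2.
    pose proof (is_derive_flux_comp f u x _ H (Hd1 x)) as H4.
    change (Derive_n u 2 x) with (Derive (Derive u) x) in H3.
    rewrite (is_derive_unique _ x _ H4) in H3. rewrite H3 in H2.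
    pose proof (is_derive_minus _ _ x _ _ H2 H4) as H5.
    unfold minus, plus, opp in H5; simpl in H5. rewrite Rplus_opp_r in H5.
    exact H5. }
  assert (Hk : forall x, Derive u x = f (u x) + E 0).
  { intros x.
    assert (E x = E 0).
    { pose proof (Rle_abs x). pose proof (Rle_abs (- x)). rewrite Rabs_Ropp in *.
      apply constant_on_interval with (- Rabs x) (Rabs x); try lra.
      - intros y _. now apply is_derive_continuity_pt with 0.
      - intros y _. apply HE. }
    unfold E in *. lra. }
  set (l := E 0 + f a).
  assert (Hl : l = 0).
  { destruct (Req_dec l 0) as [Hl | Hl]; trivial. exfalso.
    pose proof (Rabs_pos_lt l Hl) as Hl0.
    assert (Hf : is_lim (fun x => f (u x)) m_infty (f a)).
    { apply (filterlim_comp _ _ _ u f _ (locally a)); trivial.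
      now apply flux_continuous. }
    apply is_lim_spec in Hf. apply is_lim_spec in Hm.
    assert (He : 0 < Rabs l / 8) by lra.
    destruct (Hf (mkposreal _ He)) as [M1 HM1].
    destruct (Hm (mkposreal _ He)) as [M2 HM2]. simpl in HM1, HM2.
    set (M := Rmin M1 M2 - 2).
    assert (HM : M < M1 - 1 /\ M < M2 - 1).
    { unfold M, Rmin; destruct (Rle_dec M1 M2); lra. }
    destruct (MVT_gen u M (M + 1) (Derive u)) as [c [Hc1 Hc2]].
    - intros; apply Hd1.
    - intros z _. apply is_derive_continuity_pt with (Derive u z), Hd1.
    - rewrite Rmin_left, Rmax_right in Hc1 by lra.
      pose proof (HM1 c ltac:(lra)) as B1.
      pose proof (HM2 M ltac:(lra)) as B2.
      pose proof (HM2 (M + 1) ltac:(lra)) as B3.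
      rewrite Hk in Hc2. replace (M + 1 - M) with 1 in Hc2 by ring.
      rewrite Rmult_1_r in Hc2.
      assert (Hle : l = (u (M + 1) - a) - (u M - a) - (f (u c) - f a)).
      { unfold l. lra. }
      apply Rabs_def2 in B1. apply Rabs_def2 in B2. apply Rabs_def2 in B3.
      assert (Rabs l <= Rabs l / 2) by (apply Rabs_le; lra). lra. }
  intros x. replace (f (u x) - f a) with (Derive u x); [apply Hd1|].
  rewrite Hk. unfold l in Hl. lra.
Qed.

Lemma is_shock_shock (f : R -> R) (a : R) :
  convex_flux f -> 0 < a -> is_shock f a (shock f a).
Proof. intros H Ha. unfold shock. apply epsilon_spec. now apply exists_shock. Qed.

Lemma is_derive_shock (f : R -> R) (a x : R) :
  convex_flux f -> 0 < a ->
  is_derive (shock f a) x (f (shock f a x) - f a).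
Proof.
  intros H Ha. apply is_shock_first_integral; trivial. now apply is_shock_shock.
Qed.

Lemma shock_0 (f : R -> R) (a : R) :
  convex_flux f -> 0 < a -> shock f a 0 = 0.
Proof. intros H Ha. now apply (is_shock_shock f a H Ha). Qed.

Lemma continuous_shock (f : R -> R) (a x : R) :
  convex_flux f -> 0 < a -> continuous (shock f a) x.
Proof.
  intros H Ha. apply (ex_derive_continuous (shock f a) x).
  eexists. now apply is_derive_shock.
Qed.

Lemma shock_below (f : R -> R) (a x : R) :
  convex_flux f -> 0 < a -> f (shock f a x) < f a.
Proof.
  intros H Ha. pose proof (Rle_abs x). pose proof (Rle_abs (- x)).
  rewrite Rabs_Ropp in *.
  apply (flux_below_preserved f (shock f a) 1 (f a) (- Rabs x) (Rabs x) 0 H);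
    try lra.
  - intros; now apply continuous_shock.
  - intros. rewrite Rmult_1_l. now apply is_derive_shock.
  - rewrite shock_0, (flux_at_0 f H) by trivial. now apply flux_pos.
Qed.

Lemma shock_between (f : R -> R) (a x : R) :
  convex_flux f -> 0 < a -> dagger f a < shock f a x < a.
Proof. intros H Ha. apply (flux_lt_level f); trivial. now apply shock_below. Qed.

(** The derivative of the travel time along [v] is [v' / (f a - f v) = - kappa]. This plays the part
    of uniqueness for the initial value problem. *)
Lemma travel_time_along (f v : R -> R) (a kappa s t : R) :
  convex_flux f -> 0 < a -> (forall x, continuous v x) ->
  (forall x, s < x < t -> is_derive v x (kappa * (f (v x) - f a))) ->
  (forall x, s <= x <= t -> f (v x) < f a) ->
  forall x y, s <= x <= t -> s <= y <= t ->
    travel_time f a (v x) + kappa * x = travel_time f a (v y) + kappa * y.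
Proof.
  intros H Ha Hv Hd Hlt x y Hx Hy.
  assert (HT : forall z, s <= z <= t ->
    is_derive (travel_time f a) (v z) (/ (f a - f (v z)))).
  { intros z Hz. apply is_derive_travel_time; trivial.
    apply (flux_lt_level f); trivial. now apply Hlt. }
  apply (constant_on_interval (fun x => travel_time f a (v x) + kappa * x) s t);
    trivial.
  - intros z Hz. apply continuity_pt_filterlim.
    apply (continuous_plus (fun x => travel_time f a (v x)) (fun x => kappa * x)).
    + apply (continuous_comp v (travel_time f a)); trivial.
      apply (ex_derive_continuous (travel_time f a)). eexists. now apply HT.
    + apply (ex_derive_continuous (fun x => kappa * x)). auto_derive; trivial.
  - intros z Hz.
    pose proof (is_derive_comp _ v z _ _ (HT z ltac:(lra)) (Hd z Hz)) as H1.
    pose proof (is_derive_scal (fun x : R => x) z kappa 1 (is_derive_id z)) as H2.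
    pose proof (is_derive_plus _ _ z _ _ H1 H2) as H3.
    assert (Hz' : f (v z) < f a) by (apply Hlt; lra).
    unfold plus, scal in H3; simpl in H3; unfold mult in H3; simpl in H3.
    replace 0 with (kappa * (f (v z) - f a) * / (f a - f (v z)) + kappa * 1);
      [exact H3 | field; lra].
Qed.

Lemma travel_time_shock (f : R -> R) (a x : R) :
  convex_flux f -> 0 < a -> travel_time f a (shock f a x) = - x.
Proof.
  intros H Ha. pose proof (Rle_abs x). pose proof (Rle_abs (- x)).
  rewrite Rabs_Ropp in *.
  pose proof (travel_time_along f (shock f a) a 1 (- Rabs x) (Rabs x) H Ha
    (fun x => continuous_shock f a x H Ha)) as Ht.
  specialize (Ht ltac:(intros; rewrite Rmult_1_l; now apply is_derive_shock)
    ltac:(intros; now apply shock_below) x 0 ltac:(lra) ltac:(lra)).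
  rewrite shock_0, travel_time_0 in Ht by trivial. lra.
Qed.

Lemma shock_travel_time (f : R -> R) (a y : R) :
  convex_flux f -> 0 < a -> dagger f a < y < a ->
  shock f a (- travel_time f a y) = y.
Proof.
  intros H Ha Hy. apply (travel_time_inj f a); trivial.
  - now apply shock_between.
  - rewrite travel_time_shock by trivial. ring.
Qed.

Lemma shock_inj (f : R -> R) (a x y : R) :
  convex_flux f -> 0 < a -> shock f a x = shock f a y -> x = y.
Proof.
  intros H Ha He. pose proof (travel_time_shock f a x H Ha) as Ht.
  rewrite He, travel_time_shock in Ht by trivial. lra.
Qed.

Lemma shock_lt_reg (f : R -> R) (a x y : R) :
  convex_flux f -> 0 < a -> shock f a y < shock f a x -> x < y.
Proof.
  intros H Ha He.
  pose proof (shock_between f a x H Ha). pose proof (shock_between f a y H Ha).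
  pose proof (travel_time_increasing f a _ _ H Ha
    ltac:(apply H1) He ltac:(apply H0)) as Ht.
  rewrite !travel_time_shock in Ht by trivial. lra.
Qed.

Lemma shock_phi (f : R -> R) (a y : R) :
  convex_flux f -> 0 < a -> dagger f a < y < a -> shock f a (phi f a y) = y.
Proof.
  intros H Ha Hy. unfold phi.
  apply (epsilon_spec (inhabits 0) (fun x => shock f a x = y)).
  exists (- travel_time f a y). now apply shock_travel_time.
Qed.

(** * Solutions as pieces of shocks *)

(** A point of the range is recovered from its travel time, and along [v] the travel time is affine
    in [x]. *)
Lemma shock_representation (f v : R -> R) (a kappa s t x0 : R) :
  convex_flux f -> 0 < a -> (forall x, continuous v x) ->
  (forall x, s < x < t -> is_derive v x (kappa * (f (v x) - f a))) ->
  s <= x0 <= t -> f (v x0) < f a ->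
  exists lam, forall x, s <= x <= t -> v x = shock f a (kappa * x + lam).
Proof.
  intros H Ha Hv Hd Hx0 Hlt.
  pose proof (flux_below_preserved f v kappa (f a) s t x0 H Hv Hd Hx0 Hlt) as Hb.
  exists (- (travel_time f a (v x0) + kappa * x0)). intros x Hx.
  rewrite <- (travel_time_along f v a kappa s t H Ha Hv Hd Hb x x0 Hx Hx0).
  replace (kappa * x + - (travel_time f a (v x) + kappa * x))
    with (- travel_time f a (v x)) by ring.
  symmetry. apply shock_travel_time; trivial.
  apply (flux_lt_level f); trivial. now apply Hb.
Qed.

(* Clamping turns continuity relative to [0,1] into continuity on the line. *)
Lemma continuous_clamp (v : R -> R) :
  continuous_on (fun x => 0 <= x <= 1) v ->
  forall x, continuous (fun x => v (Rmax 0 (Rmin 1 x))) x.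
Proof.
  intros Hv x. set (c := fun x => Rmax 0 (Rmin 1 x)).
  assert (Hc : forall x, 0 <= c x <= 1).
  { intros z. unfold c, Rmax, Rmin. destruct (Rle_dec 1 z);
      destruct (Rle_dec 0 _); lra. }
  apply filterlim_locally. intros e.
  pose proof (proj1 (filterlim_locally _ _) (Hv (c x) (Hc x)) e) as [r Hr].
  exists r. intros y Hy. apply Hr; [|apply Hc].
  revert Hy. unfold ball; simpl; unfold AbsRing_ball, abs, minus, plus, opp; simpl.
  apply Rle_lt_trans. unfold c, Rmax, Rmin.
  destruct (Rle_dec 1 x); destruct (Rle_dec 1 y);
    repeat destruct (Rle_dec 0 _); unfold Rabs;
    repeat destruct (Rcase_abs _); lra.
Qed.

(** The first integral gives [eps v' = f v + k] inside the interval. Since [u1 < u0], the mean value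
    theorem provides a point with [f v < - k]; as [f >= 0], the level [- k] is positive, hence equal
    to [f a] for some [a > 0]. The clamped function [w] carries the representation up to both
    endpoints. *)
Lemma bvp_is_shock (f v : R -> R) (eps u0 u1 : R) :
  convex_flux f -> u1 < u0 -> 0 < eps -> is_bvp_solution f eps u0 u1 v ->
  exists a lam, 0 < a /\
    forall x, 0 <= x <= 1 -> v x = shock f a (x / eps + lam).
Proof.
  intros H Hu Heps [Hc [Hd [H0 H1]]].
  set (w := fun x => v (Rmax 0 (Rmin 1 x))).
  assert (Hw : forall x, continuous w x) by (now apply continuous_clamp).
  assert (Hwv : forall x, 0 <= x <= 1 -> w x = v x).
  { intros x Hx. unfold w. now rewrite Rmin_right, Rmax_right by lra. }
  assert (Hd1 : forall x, 0 < x < 1 -> is_derive v x (Derive v x)).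
  { intros x Hx. now apply Derive_correct, Hd. }
  set (E := fun x => eps * Derive v x - f (v x)).
  assert (HE : forall x, 0 < x < 1 -> is_derive E x 0).
  { intros x Hx. destruct (Hd x Hx) as [_ [H2 H3]].
    apply Derive_correct in H2.
    pose proof (is_derive_flux_comp f v x _ H (Hd1 x Hx)) as H4.
    change (Derive_n v 2 x) with (Derive (Derive v) x) in H3.
    apply (is_derive_scal _ x eps) in H2. rewrite H3 in H2.
    rewrite (is_derive_unique _ x _ H4) in H2.
    pose proof (is_derive_minus _ _ x _ _ H2 H4) as H5.
    unfold minus, plus, opp in H5; simpl in H5. rewrite Rplus_opp_r in H5.
    exact H5. }
  set (k := E (1 / 2)).
  assert (Hk : forall x, 0 < x < 1 -> Derive v x = / eps * (f (v x) + k)).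
  { intros x Hx.
    assert (E x = k).
    { unfold k. set (m := Rmin x (1 / 2)). set (M := Rmax x (1 / 2)).
      assert (Hm : 0 < m /\ m <= x /\ m <= 1 / 2 /\ M < 1 /\ x <= M /\ 1 / 2 <= M).
      { unfold m, M, Rmin, Rmax; destruct (Rle_dec x (1 / 2)); lra. }
      apply constant_on_interval with m M; try lra.
      - intros y Hy. apply is_derive_continuity_pt with 0, HE. lra.
      - intros y Hy. apply HE. lra. }
    unfold E in *. rewrite <- H2. field. lra. }
  assert (Hdw : forall x, 0 < x < 1 -> is_derive w x (/ eps * (f (w x) + k))).
  { intros x Hx. apply is_derive_ext_loc with v.
    - apply (locally_interval _ x 0 1); [apply Hx | apply Hx |].
      intros y Hy1 Hy2. simpl in Hy1, Hy2. symmetry. apply Hwv. lra.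
    - rewrite Hwv, <- Hk by lra. now apply Hd1. }
  assert (Hneg : exists x0, 0 <= x0 <= 1 /\ f (w x0) < - k).
  { destruct (MVT_gen w 0 1 (fun x => / eps * (f (w x) + k))) as [c [Hc1 Hc2]].
    - intros z Hz. rewrite Rmin_left, Rmax_right in Hz by lra. now apply Hdw.
    - intros z _. apply continuity_pt_filterlim, Hw.
    - rewrite Rmin_left, Rmax_right in Hc1 by lra.
      exists c. split; trivial. rewrite !Hwv, H0, H1 in Hc2 by lra.
      rewrite Hwv in * by lra.
      pose proof (Rinv_0_lt_compat eps Heps).
      destruct (Rlt_le_dec (f (v c)) (- k)); trivial. exfalso. nra. }
  destruct Hneg as [x0 [Hx0 Hlt]].
  pose proof (flux_nonneg f (w x0) H) as Hnn.
  destruct (flux_onto_pos f (- k) H) as [a [Ha1 Ha2]]; [lra|].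
  destruct (shock_representation f w a (/ eps) 0 1 x0) as [lam Hlam]; trivial.
  - intros x Hx. rewrite Ha2.
    replace (f (w x) - - k) with (f (w x) + k) by ring. now apply Hdw.
  - lra.
  - exists a, lam. split; trivial. intros x Hx.
    rewrite <- Hwv, Hlam by lra. f_equal. unfold Rdiv. ring.
Qed.

Lemma is_derive_shock_affine (f : R -> R) (a kappa lam x : R) :
  convex_flux f -> 0 < a ->
  is_derive (fun x => shock f a (kappa * x + lam)) x
    (kappa * (f (shock f a (kappa * x + lam)) - f a)).
Proof.
  intros H Ha.
  apply (is_derive_comp (shock f a) (fun x => kappa * x + lam)).
  - now apply is_derive_shock.
  - auto_derive; trivial. ring.
Qed.

(** Equal values and equal derivatives at an interior point force equal levels, so [a = b]; the
    shifts then agree because the shock is injective. *)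
Lemma shock_representation_unique (f : R -> R) (a b eps lam mu : R) :
  convex_flux f -> 0 < a -> 0 < b -> 0 < eps ->
  (forall x, 0 <= x <= 1 ->
     shock f a (x / eps + lam) = shock f b (x / eps + mu)) ->
  a = b /\ lam = mu.
Proof.
  intros H Ha Hb Heps He.
  assert (He' : forall x, 0 <= x <= 1 ->
     shock f a (/ eps * x + lam) = shock f b (/ eps * x + mu)).
  { intros x Hx. specialize (He x Hx). unfold Rdiv in He.
    now rewrite (Rmult_comm (/ eps)). }
  pose proof (is_derive_shock_affine f a (/ eps) lam (1 / 2) H Ha) as D1.
  pose proof (is_derive_shock_affine f b (/ eps) mu (1 / 2) H Hb) as D2.
  apply (is_derive_ext_loc _ (fun x => shock f b (/ eps * x + mu))) in D1.
  - apply is_derive_unique in D1. apply is_derive_unique in D2.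
    rewrite D1 in D2. rewrite (He' (1 / 2)) in D2 by lra.
    apply Rmult_eq_reg_l in D2; [|apply Rinv_neq_0_compat; lra].
    assert (Hab : a = b) by (apply (flux_inj_pos f); trivial; lra).
    split; trivial. subst b.
    specialize (He 0 ltac:(lra)). apply shock_inj in He; trivial. lra.
  - apply (locally_interval _ (1 / 2) 0 1); simpl; try lra.
    intros y Hy1 Hy2. simpl in Hy1, Hy2. apply He'. lra.
Qed.

(** * The shift integrand and its singularity *)

Definition slope (g : R -> R) (x z : R) : R :=
  if Req_EM_T z x then Derive g x else (g z - g x) / (z - x).

Lemma slope_spec (g : R -> R) (x z : R) : g z - g x = slope g x z * (z - x).
Proof.
  unfold slope. destruct (Req_EM_T z x) as [-> | Hz]; [ring | field; lra].
Qed.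

Lemma continuous_slope (g : R -> R) (x z : R) :
  (forall y, ex_derive g y) -> continuous (slope g x) z.
Proof.
  intros Hg. destruct (Req_EM_T z x) as [-> | Hz].
  - apply filterlim_locally. intros e.
    pose proof (proj1 (is_derive_Reals _ _ _) (Derive_correct g x (Hg x))
                  e (cond_pos e)) as [r Hr].
    exists r. intros y Hy.
    unfold ball in *; simpl in *;
      unfold AbsRing_ball, abs, minus, plus, opp in *; simpl in *.
    unfold slope. destruct (Req_EM_T x x) as [_ | Hx]; [|easy].
    destruct (Req_EM_T y x) as [-> | Hyx].
    + rewrite Rplus_opp_r, Rabs_R0. apply cond_pos.
    + specialize (Hr (y - x) ltac:(lra) Hy).
      now replace (x + (y - x)) with y in Hr by ring.
  - apply continuous_ext_loc with (fun y => (g y - g x) / (y - x)).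
    + assert (Hr : 0 < Rabs (z - x)) by (apply Rabs_pos_lt; lra).
      exists (mkposreal _ Hr). intros y Hy.
      unfold ball in Hy; simpl in Hy;
        unfold AbsRing_ball, abs, minus, plus, opp in Hy; simpl in Hy.
      unfold slope. destruct (Req_EM_T y x) as [-> | _]; trivial.
      change (Rabs (x - z) < Rabs (z - x)) in Hy.
      rewrite (Rabs_minus_sym x z) in Hy. lra.
    + apply (ex_derive_continuous (fun y => (g y - g x) / (y - x))).
      auto_derive. split; [apply Hg | split; trivial; lra].
Qed.

(** With [c = f u] this is an integrand of [shock_shift]. For [c > f u] it is [f'(u)] times the
    travel-time density, minus the derivative of [- ln (c - f z)]. *)
Definition shift_integrand (f : R -> R) (u c z : R) : R :=
  (Derive f u - Derive f z) / (c - f z).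

(** The interval may contain 0, so [f] need not be monotone on it; the chord from [y0] to [u]
    replaces monotonicity. *)
Lemma gap_pos (f : R -> R) (y0 u z : R) :
  convex_flux f -> f y0 < f u -> y0 <= z < u -> 0 < f u - f z.
Proof.
  intros H Hlt Hz. pose proof (chord_le f y0 z u H ltac:(lra)).
  assert (0 < (f u - f y0) * (u - z)) by (apply Rmult_lt_0_compat; lra).
  nra.
Qed.

Lemma Derive_pos_of_rise (f : R -> R) (y0 u : R) :
  convex_flux f -> y0 < u -> f y0 < f u -> 0 < Derive f u.
Proof. intros H Hy Hlt. pose proof (tangent_le f u y0 H). nra. Qed.

(* At [z = u] the integrand is 0/0; the quotient of the difference quotients of
   [Derive f] and [f] at [u] is its continuous extension. *)
Lemma shift_integrand_extension (f : R -> R) (y0 u : R) :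
  convex_flux f -> y0 < u -> f y0 < f u ->
  exists r : R -> R, (forall z, y0 <= z <= u -> continuous r z) /\
    forall z, y0 <= z < u -> shift_integrand f u (f u) z = r z.
Proof.
  intros H Hy Hlt.
  exists (fun z => slope (Derive f) u z / slope f u z). split.
  - intros z Hz.
    apply (continuous_mult (slope (Derive f) u) (fun z => / slope f u z)).
    + apply continuous_slope, (flux_ex2 f H).
    + apply (continuous_comp (slope f u) Rinv).
      * apply continuous_slope, (flux_ex f H).
      * apply (ex_derive_continuous Rinv). auto_derive.
        destruct (Req_dec z u) as [-> | Hzu].
        -- unfold slope. destruct (Req_EM_T u u) as [_ | Hu]; [|easy].
           pose proof (Derive_pos_of_rise f y0 u H Hy Hlt). lra.
        -- pose proof (gap_pos f y0 u z H Hlt ltac:(lra)).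
           pose proof (slope_spec f u z) as Hs. intros He. rewrite He in Hs. lra.
  - intros z Hz. unfold shift_integrand.
    pose proof (gap_pos f y0 u z H Hlt ltac:(lra)) as Hg.
    pose proof (slope_spec f u z) as H1.
    pose proof (slope_spec (Derive f) u z) as H2.
    assert (slope f u z <> 0) by (intros H3; rewrite H3 in H1; lra).
    replace (Derive f u - Derive f z) with (- (slope (Derive f) u z * (z - u))) by lra.
    replace (f u - f z) with (- (slope f u z * (z - u))) by lra.
    field. split; lra.
Qed.

Lemma ex_RInt_shift_integrand (f : R -> R) (y0 u : R) :
  convex_flux f -> y0 < u -> f y0 < f u ->
  ex_RInt (shift_integrand f u (f u)) y0 u.
Proof.
  intros H Hy Hlt.
  destruct (shift_integrand_extension f y0 u H Hy Hlt) as [r [Hr1 Hr2]].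
  apply ex_RInt_ext with r.
  - intros z Hz. rewrite Rmin_left, Rmax_right in Hz by lra.
    symmetry. apply Hr2. lra.
  - apply (ex_RInt_continuous r). intros z Hz.
    rewrite Rmin_left, Rmax_right in Hz by lra. now apply Hr1.
Qed.

(** [K] dominates the maximum of the continuous extension. In this form the bound includes [z = u],
    and since [c - f z >= f u - f z] it controls the shift integrand on all levels [c > f u] at
    once. *)
Lemma shift_numerator_bound (f : R -> R) (y0 u : R) :
  convex_flux f -> y0 < u -> f y0 < f u ->
  exists K, 0 < K /\ forall z, y0 <= z <= u ->
    0 <= Derive f u - Derive f z <= K * (f u - f z).
Proof.
  intros H Hy Hlt.
  destruct (shift_integrand_extension f y0 u H Hy Hlt) as [r [Hr1 Hr2]].
  destruct (continuity_ab_maj r y0 u) as [m [Hm _]]; [lra | |].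
  { intros z Hz. now apply continuity_pt_filterlim, Hr1. }
  exists (Rmax 1 (r m)). split.
  { pose proof (Rmax_l 1 (r m)); lra. }
  intros z Hz. destruct (Req_dec z u) as [-> | Hzu]; [lra|].
  assert (Hlt' : z < u) by lra.
  pose proof (flux_incr f H z u Hlt').
  pose proof (gap_pos f y0 u z H Hlt ltac:(lra)) as Hg.
  split; [lra|].
  assert (He : Derive f u - Derive f z = r z * (f u - f z)).
  { rewrite <- Hr2 by lra. unfold shift_integrand. field. lra. }
  rewrite He. apply Rmult_le_compat_r; [lra|].
  apply Rle_trans with (r m); [now apply Hm | apply Rmax_r].
Qed.

(* [c] is the flux level of the orbit, run backwards so that it increases. *)
Definition rising_orbit (f : R -> R) (c : R) (y : R -> R) : Prop :=
  forall t, is_derive y t (c - f (y t)) /\ f (y t) < c.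

Lemma continuous_rising_orbit (f : R -> R) (c : R) (y : R -> R) (t : R) :
  rising_orbit f c y -> continuous y t.
Proof.
  intros Hy. apply (ex_derive_continuous y). eexists. apply Hy.
Qed.

Lemma continuous_shift_integrand (f : R -> R) (u c z : R) :
  convex_flux f -> f z < c -> continuous (shift_integrand f u c) z.
Proof.
  intros H Hz.
  apply (continuous_mult (fun z => Derive f u - Derive f z) (fun z => / (c - f z))).
  - apply (continuous_minus (fun _ => Derive f u) (Derive f)).
    + apply continuous_const.
    + now apply flux_continuous_derive.
  - now apply continuous_inv_gap.
Qed.

(** * Exact arrival times and comparison of orbits *)

Lemma orbit_time (f : R -> R) (c : R) (y : R -> R) (T : R) :
  convex_flux f -> rising_orbit f c y ->
  RInt (fun z => / (c - f z)) (y 0) (y T) = T.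
Proof.
  intros H Hy.
  assert (H1 : is_RInt (fun t => scal (c - f (y t)) (/ (c - f (y t)))) 0 T
                 (RInt (fun z => / (c - f z)) (y 0) (y T))).
  { apply (is_RInt_comp (fun z => / (c - f z)) y (fun t => c - f (y t))).
    - intros t _. apply continuous_inv_gap; trivial. apply Hy.
    - intros t _. split; [apply Hy|].
      apply (continuous_minus (fun _ => c) (fun t => f (y t))).
      + apply continuous_const.
      + apply continuous_flux_comp; trivial.
        now apply continuous_rising_orbit with f c. }
  assert (H2 : is_RInt (fun _ => 1) 0 T (RInt (fun z => / (c - f z)) (y 0) (y T))).
  { revert H1. apply is_RInt_ext. intros t _.
    unfold scal; simpl; unfold mult; simpl. apply Rinv_r.
    pose proof (proj2 (Hy t)). lra. }
  apply (is_RInt_unique (V := R_CompleteNormedModule)) in H2. rewrite <- H2, RInt_const.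
  unfold scal; simpl; unfold mult; simpl. ring.
Qed.

(* Along an orbit [(ln (c - f y))' = - f'(y)], which compares the exact
   travel time with its logarithmic leading term. *)
Lemma orbit_log (f : R -> R) (c u : R) (y : R -> R) (T : R) :
  convex_flux f -> rising_orbit f c y ->
  RInt (shift_integrand f u c) (y 0) (y T)
  = Derive f u * T + ln (c - f (y T)) - ln (c - f (y 0)).
Proof.
  intros H Hy.
  assert (Hyc : forall t, continuous y t).
  { intros t. now apply continuous_rising_orbit with f c. }
  assert (H1 : is_RInt (fun t => scal (c - f (y t)) (shift_integrand f u c (y t))) 0 T
                 (RInt (shift_integrand f u c) (y 0) (y T))).
  { apply (is_RInt_comp (shift_integrand f u c) y (fun t => c - f (y t))).
    - intros t _. apply continuous_shift_integrand; trivial. apply Hy.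
    - intros t _. split; [apply Hy|].
      apply (continuous_minus (fun _ => c) (fun t => f (y t))).
      + apply continuous_const.
      + now apply continuous_flux_comp. }
  set (E := fun t => Derive f u * t + ln (c - f (y t))).
  assert (H2 : is_RInt (fun t => Derive f u - Derive f (y t)) 0 T (minus (E T) (E 0))).
  { apply (is_RInt_derive E).
    - intros t _. destruct (Hy t) as [Hd Hlt].
      pose proof (is_derive_flux_comp f y t _ H Hd) as Hw.
      set (w := fun t => f (y t)) in *. unfold E.
      change (fun t : R => Derive f u * t + ln (c - f (y t)))
        with (fun t : R => Derive f u * t + ln (c - w t)).
      replace (Derive f u - Derive f (y t)) with
        (Derive f u - (c - f (y t)) * Derive f (y t) / (c - w t))
        by (unfold w; field; lra).
      change (f (y t) < c) with (w t < c) in Hlt.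
      set (lw := (c - f (y t)) * Derive f (y t)) in *.
      clearbody w lw. auto_derive.
      + split; [now exists lw | split; trivial; lra].
      + change (fun x : R => w x) with w.
        rewrite (is_derive_unique w t _ Hw). unfold Rdiv, Rminus. ring.
    - intros t _. apply (continuous_minus (fun _ => Derive f u) (fun t => Derive f (y t))).
      + apply continuous_const.
      + apply (continuous_comp y (Derive f)); trivial.
        now apply flux_continuous_derive. }
  assert (H3 : is_RInt (fun t => Derive f u - Derive f (y t)) 0 T
                 (RInt (shift_integrand f u c) (y 0) (y T))).
  { revert H1. apply is_RInt_ext. intros t _.
    unfold scal; simpl; unfold mult; simpl. unfold shift_integrand.
    pose proof (proj2 (Hy t)). field. lra. }
  apply (is_RInt_unique (V := R_CompleteNormedModule)) in H2. apply (is_RInt_unique (V := R_CompleteNormedModule)) in H3.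
  rewrite <- H3, H2. unfold E, minus, plus, opp; simpl. ring.
Qed.

(** The integrands at levels [f u] and [c] differ by the former times [(c - f u) / (c - f z)], at
    most [K (c - f u) / (c - f z)], and the integral of [1 / (c - f z)] is exactly [T]. The last
    bound holds because the speed is at least [c - f u] on the way. *)
Lemma orbit_arrival (f : R -> R) (y0 u : R) :
  convex_flux f -> y0 < u -> f y0 < f u ->
  exists K, 0 < K /\ forall c y T,
    f u < c -> 0 <= T -> rising_orbit f c y -> y 0 = y0 -> y T = u ->
    let I := RInt (shift_integrand f u c) y0 u in
    Derive f u * T = I + ln (c - f y0) - ln (c - f u) /\
    0 <= I <= K /\
    Rabs (I - RInt (shift_integrand f u (f u)) y0 u) <= K * (c - f u) * T /\
    (c - f u) * T <= u - y0.
Proof.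
  intros H Hy Hlt.
  destruct (shift_numerator_bound f y0 u H Hy Hlt) as [K [HK HKb]].
  (* [K] bounds the integrand, [K * (u - y0)] its integral. *)
  exists (Rmax K (K * (u - y0))).
  pose proof (Rmax_l K (K * (u - y0))) as HK1.
  pose proof (Rmax_r K (K * (u - y0))) as HK2.
  set (K' := Rmax K (K * (u - y0))) in *. clearbody K'.
  split; [lra|].
  intros c y T Hc HT Ho H0 H1 I.
  pose proof (orbit_log f c u y T H Ho) as Hlog.
  pose proof (orbit_time f c y T H Ho) as Htime.
  rewrite H0, H1 in Hlog, Htime. fold I in Hlog.
  assert (Hbelow : forall z, y0 <= z <= u -> f z <= f u).
  { intros z Hz. pose proof (HKb z Hz). nra. }
  assert (Hex : ex_RInt (shift_integrand f u c) y0 u).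
  { apply (ex_RInt_continuous (shift_integrand f u c)). intros z Hz.
    rewrite Rmin_left, Rmax_right in Hz by lra.
    apply continuous_shift_integrand; trivial. specialize (Hbelow z Hz). lra. }
  assert (Hext : ex_RInt (fun z => / (c - f z)) y0 u).
  { apply (ex_RInt_continuous (fun z => / (c - f z))). intros z Hz.
    rewrite Rmin_left, Rmax_right in Hz by lra.
    apply continuous_inv_gap; trivial. specialize (Hbelow z Hz). lra. }
  pose proof (ex_RInt_shift_integrand f y0 u H Hy Hlt) as Hex0.
  assert (Hpt : forall z, y0 < z < u ->
    0 <= shift_integrand f u c z <= K /\
    0 <= shift_integrand f u (f u) z - shift_integrand f u c z
      <= K * (c - f u) * / (c - f z)).
  { intros z Hz. specialize (HKb z ltac:(lra)).
    pose proof (gap_pos f y0 u z H Hlt ltac:(lra)) as Hg.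
    unfold shift_integrand.
    assert (Hi : 0 < / (c - f z)) by (apply Rinv_0_lt_compat; lra).
    assert (Hi0 : 0 < / (f u - f z)) by (now apply Rinv_0_lt_compat).
    split; [split|].
    - apply Rmult_le_pos; lra.
    - apply Rmult_le_reg_r with (c - f z); [lra|].
      unfold Rdiv. rewrite Rmult_assoc, Rinv_l by lra. nra.
    - replace ((Derive f u - Derive f z) / (f u - f z)
               - (Derive f u - Derive f z) / (c - f z))
        with ((Derive f u - Derive f z) * / (f u - f z) * ((c - f u) * / (c - f z)))
        by (field; split; lra).
      assert (Hw : 0 <= (c - f u) * / (c - f z)) by (apply Rmult_le_pos; lra).
      assert (Hn : 0 <= (Derive f u - Derive f z) * / (f u - f z) <= K).
      { split; [apply Rmult_le_pos; lra|].
        apply Rmult_le_reg_r with (f u - f z); [lra|].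
        rewrite Rmult_assoc, Rinv_l by lra. lra. }
      split; [apply Rmult_le_pos; lra|].
      rewrite (Rmult_assoc K). now apply Rmult_le_compat_r. }
  split; [|split; [|split]].
  - lra.
  - split.
    + apply RInt_ge_0; [lra | trivial |]. intros z Hz. apply (Hpt z Hz).
    + apply Rle_trans with (RInt (fun _ => K) y0 u).
      * apply RInt_le; [lra | trivial | apply ex_RInt_const |].
        intros z Hz. apply (Hpt z Hz).
      * rewrite RInt_const. unfold scal; simpl; unfold mult; simpl. lra.
  - rewrite Rabs_minus_sym.
    pose proof (RInt_minus _ _ _ _ Hex0 Hex) as Hm.
    unfold minus, plus, opp in Hm; simpl in Hm. fold I in Hm.
    unfold Rminus. rewrite <- Hm.
    assert (Hexd : ex_RInt (fun z => shift_integrand f u (f u) z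
                              + - shift_integrand f u c z) y0 u).
    { exact (ex_RInt_minus _ _ _ _ Hex0 Hex). }
    rewrite Rabs_pos_eq.
    + apply Rle_trans with (RInt (fun z => K * (c - f u) * / (c - f z)) y0 u).
      * apply RInt_le; [lra | trivial | |].
        -- exact (ex_RInt_scal (fun z => / (c - f z)) y0 u (K * (c - f u)) Hext).
        -- intros z Hz. apply (Hpt z Hz).
      * pose proof (RInt_scal (fun z => / (c - f z)) y0 u (K * (c - f u)) Hext) as Hs.
        unfold scal in Hs; simpl in Hs; unfold mult in Hs; simpl in Hs.
        rewrite Hs, Htime. fold (c - f u).
        apply Rmult_le_compat_r; trivial. apply Rmult_le_compat_r; lra.
    + apply RInt_ge_0; [lra | trivial |]. intros z Hz.
      apply (Hpt z Hz).
  - assert (HTb : T <= (u - y0) * / (c - f u)).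
    { rewrite <- Htime. apply Rle_trans with (RInt (fun _ => / (c - f u)) y0 u).
      - apply RInt_le; [lra | trivial | apply ex_RInt_const |].
        intros z Hz. apply Rinv_le_contravar; [lra|].
        specialize (Hbelow z ltac:(lra)). lra.
      - rewrite RInt_const. apply Rle_refl. }
    apply Rmult_le_reg_r with (/ (c - f u)); [apply Rinv_0_lt_compat; lra|].
    replace ((c - f u) * T * / (c - f u)) with T by (field; lra). exact HTb.
Qed.

(* By convexity [(y - z) / g] has derivative at most [(c - F) / g] with
   [g = F - f z], and [1 / (m^2 (u - z))] is a primitive dominating [1 / g]. *)
Lemma orbit_comparison_upper (f : R -> R) (y0 u c : R) (y z : R -> R) (t : R) :
  convex_flux f -> y0 < u -> f y0 < f u -> f u < c ->
  rising_orbit f c y -> rising_orbit f (f u) z ->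
  y 0 = y0 -> z 0 = y0 -> (forall s, z s < u) -> 0 <= t ->
  y t - z t <= Derive f u * ((u - y0) / (f u - f y0)) ^ 2 * (c - f u).
Proof.
  intros H Hyu Hlt Hc Hy Hz Hy0 Hz0 Hzu Ht.
  (* [k] is the inverse [1 / m] of the slope of the chord over [[y0, u]]; [chord_le] gives
     [u - z <= k * g]. *)
  set (d := c - f u). set (k := (u - y0) / (f u - f y0)).
  assert (Hk : 0 < k) by (apply Rdiv_lt_0_compat; lra).
  assert (Hz_ge : forall s, 0 <= s -> y0 <= z s).
  { intros s Hs. rewrite <- Hz0.
    apply nondecreasing_of_derive with (fun s => f u - f (z s)); trivial.
    - intros x _. apply Hz.
    - intros x _. pose proof (proj2 (Hz x)). lra. }
  set (P := fun s => d * k ^ 2 * / (u - z s) - (y s - z s) * / (f u - f (z s))).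
  set (dP := fun s =>
    d * k ^ 2 * ((f u - f (z s)) / (u - z s) ^ 2)
    - (c - f (y s) - (f u - f (z s)) + Derive f (z s) * (y s - z s))
      * / (f u - f (z s))).
  assert (HP : P 0 <= P t).
  { apply nondecreasing_of_derive with dP; trivial.
    - intros s Hs.
      destruct (Hz s) as [Hdz Hgz]. destruct (Hy s) as [Hdy _].
      pose proof (is_derive_flux_comp f z s _ H Hdz) as Hw.
      specialize (Hzu s).
      unfold P, dP. set (w := fun t : R => f (z t)) in *.
      change (fun s : R => d * k ^ 2 * / (u - z s) - (y s - z s) * / (f u - f (z s)))
        with (fun s : R => d * k ^ 2 * / (u - z s) - (y s - z s) * / (f u - w s)).
      assert (Hws : w s = f (z s)) by reflexivity.
      clearbody w. auto_derive.
      + repeat split; try (eexists; eassumption); lra.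
      + change (fun x : R => w x) with w. change (fun x : R => y x) with y.
        change (fun x : R => z x) with z.
        rewrite (is_derive_unique w s _ Hw), (is_derive_unique z s _ Hdz),
          (is_derive_unique y s _ Hdy), Hws.
        field. split; lra.
    - intros s Hs. unfold dP.
      destruct (Hz s) as [_ Hgz]. specialize (Hzu s). specialize (Hz_ge s ltac:(lra)).
      set (g := f u - f (z s)) in *.
      assert (Hg : 0 < g) by (unfold g; lra).
      pose proof (chord_le f y0 (z s) u H ltac:(lra)) as Hch. fold g in Hch.
      pose proof (tangent_le f (z s) (y s) H) as Htan.
      assert (Hkg : u - z s <= k * g).
      { unfold k, Rdiv. apply Rmult_le_reg_r with (f u - f y0); [lra|].
        replace ((u - y0) * / (f u - f y0) * g * (f u - f y0))
          with (g * (u - y0)) by (field; lra). lra. }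
      assert (H1 : (c - f (y s) - g + Derive f (z s) * (y s - z s)) * / g <= d * / g).
      { apply Rmult_le_compat_r; [left; now apply Rinv_0_lt_compat|].
        unfold d, g. lra. }
      assert (H2 : d * / g <= d * k ^ 2 * (g / (u - z s) ^ 2)).
      { rewrite Rmult_assoc. apply Rmult_le_compat_l; [unfold d; lra|].
        apply Rmult_le_reg_r with (g * (u - z s) ^ 2).
        { apply Rmult_lt_0_compat; trivial. apply pow_lt. lra. }
        replace (/ g * (g * (u - z s) ^ 2)) with ((u - z s) ^ 2) by (field; lra).
        replace (k ^ 2 * (g / (u - z s) ^ 2) * (g * (u - z s) ^ 2))
          with ((k * g) ^ 2) by (field; lra).
        apply pow_incr. lra. }
      lra. }
  unfold P in HP. rewrite Hy0, Hz0 in HP.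
  assert (Hu0 : 0 < / (u - y0)) by (apply Rinv_0_lt_compat; lra).
  assert (Hd0 : 0 < d * k ^ 2 * / (u - y0)).
  { apply Rmult_lt_0_compat; trivial. apply Rmult_lt_0_compat; [unfold d; lra|].
    now apply pow_lt. }
  specialize (Hzu t). destruct (Hz t) as [_ Hgz].
  set (g := f u - f (z t)) in *.
  assert (Hg : 0 < g) by (unfold g; lra).
  (* The tangent at [u] gives [g <= f'(u) (u - z)], which absorbs the blow-up of [1 / (u - z)] and
     makes the bound uniform in time. *)
  pose proof (tangent_le f u (z t) H) as Htan.
  assert (Hmain : (y t - z t) * / g <= d * k ^ 2 * / (u - z t)) by lra.
  apply (Rmult_le_compat_r g) in Hmain; [|lra].
  rewrite Rmult_assoc, Rinv_l, Rmult_1_r in Hmain by lra.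
  apply Rle_trans with (1 := Hmain).
  replace (Derive f u * k ^ 2 * d)
    with (d * k ^ 2 * / (u - z t) * (Derive f u * (u - z t))) by (field; lra).
  apply Rmult_le_compat_l; [|unfold g; lra].
  apply Rmult_le_pos.
  - apply Rmult_le_pos; [unfold d; lra | left; now apply pow_lt].
  - left. apply Rinv_0_lt_compat. lra.
Qed.

(** Here the difference is divided by the speed of the orbit on the higher level: the tangent at [y]
    then makes the derivative of the quotient at least [(c - F) / (c - f y)]. *)
Lemma orbit_comparison_lower (f : R -> R) (c F : R) (y z : R -> R) (t : R) :
  convex_flux f -> F < c -> rising_orbit f c y -> rising_orbit f F z ->
  y 0 = z 0 -> 0 <= t -> z t <= y t.
Proof.
  intros H Hc Hy Hz H0 Ht.
  set (P := fun s => (y s - z s) * / (c - f (y s))).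
  set (dP := fun s =>
    (c - f (y s) - (F - f (z s)) + Derive f (y s) * (y s - z s))
      * / (c - f (y s))).
  assert (HP : P 0 <= P t).
  { apply nondecreasing_of_derive with dP; trivial.
    - intros s Hs.
      destruct (Hz s) as [Hdz _]. destruct (Hy s) as [Hdy Hgy].
      pose proof (is_derive_flux_comp f y s _ H Hdy) as Hw.
      unfold P, dP. set (w := fun t : R => f (y t)) in *.
      change (fun s : R => (y s - z s) * / (c - f (y s)))
        with (fun s : R => (y s - z s) * / (c - w s)).
      assert (Hws : w s = f (y s)) by reflexivity.
      clearbody w. auto_derive.
      + repeat split; try (eexists; eassumption); lra.
      + change (fun x : R => w x) with w. change (fun x : R => y x) with y.
        change (fun x : R => z x) with z.
        rewrite (is_derive_unique w s _ Hw), (is_derive_unique z s _ Hdz),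
          (is_derive_unique y s _ Hdy), Hws.
        field. lra.
    - intros s Hs. unfold dP. destruct (Hy s) as [_ Hgy].
      pose proof (tangent_le f (y s) (z s) H) as Htan.
      apply Rmult_le_pos; [lra|]. left. apply Rinv_0_lt_compat. lra. }
  unfold P in HP. rewrite H0, Rminus_diag, Rmult_0_l in HP.
  destruct (Hy t) as [_ Hgy].
  apply (Rmult_le_compat_r (c - f (y t))) in HP; [|lra].
  rewrite Rmult_assoc, Rinv_l in HP by lra. lra.
Qed.

Lemma orbit_comparison (f : R -> R) (y0 u : R) :
  convex_flux f -> y0 < u -> f y0 < f u ->
  exists K, 0 < K /\ forall c y z t,
    f u < c -> rising_orbit f c y -> rising_orbit f (f u) z ->
    y 0 = y0 -> z 0 = y0 -> (forall s, z s < u) -> 0 <= t ->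
    Rabs (y t - z t) <= K * (c - f u).
Proof.
  intros H Hyu Hlt.
  exists (Derive f u * ((u - y0) / (f u - f y0)) ^ 2). split.
  { apply Rmult_lt_0_compat; [now apply (Derive_pos_of_rise f y0)|].
    apply pow_lt, Rdiv_lt_0_compat; lra. }
  intros c y z t Hc Hy Hz Hy0 Hz0 Hzu Ht.
  rewrite Rabs_pos_eq.
  - now apply orbit_comparison_upper.
  - pose proof (orbit_comparison_lower f c (f u) y z t H Hc Hy Hz
      ltac:(congruence) Ht). lra.
Qed.

(* The scaled length [1 / eps] of the layer is [T]. *)
Lemma one_sided_estimate (f : R -> R) (y0 u : R) :
  convex_flux f -> y0 < u -> f y0 < f u ->
  exists C, 0 < C /\ forall c y z T t,
    f u < c -> 1 <= T -> 0 <= t ->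
    rising_orbit f c y -> rising_orbit f (f u) z ->
    y 0 = y0 -> z 0 = y0 -> y T = u -> (forall s, z s < u) ->
    Rabs (y t - z t) <= C * exp (- (Derive f u * T)).
Proof.
  intros H Hyu Hlt.
  destruct (orbit_arrival f y0 u H Hyu Hlt) as [K [HK HA]].
  destruct (orbit_comparison f y0 u H Hyu Hlt) as [M [HM HB]].
  (* Exponentiating the arrival formula gives [c - f u = (c - f y0) * exp I * exp (- f'(u) T)] with
     [I <= K]. As [T >= 1], also [c - f u <= (c - f u) T <= u - y0], which bounds [c - f y0]. *)
  exists (M * ((f u - f y0 + (u - y0)) * exp K)). split.
  { apply Rmult_lt_0_compat; trivial.
    apply Rmult_lt_0_compat; [lra | apply exp_pos]. }
  intros c y z T t Hc HT Ht Hy Hz Hy0 Hz0 HyT Hzu.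
  destruct (HA c y T Hc ltac:(lra) Hy Hy0 HyT) as [A1 [A2 [_ A4]]].
  apply Rle_trans with (1 := HB c y z t Hc Hy Hz Hy0 Hz0 Hzu Ht).
  rewrite Rmult_assoc. apply Rmult_le_compat_l; [lra|].
  set (I := RInt (shift_integrand f u c) y0 u) in *.
  rewrite <- (exp_ln (c - f u)) by lra.
  replace (ln (c - f u)) with (ln (c - f y0) + I + - (Derive f u * T)) by lra.
  rewrite !exp_plus, exp_ln by lra.
  apply Rmult_le_compat_r; [left; apply exp_pos|].
  apply Rmult_le_compat.
  - lra.
  - left; apply exp_pos.
  - nra.
  - destruct A2 as [_ [A2 | ->]]; [left; now apply exp_increasing | lra].
Qed.

(** * Boundary layers *)

(** A shock decreases in [x], so it rises when read from right to left. *)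
Lemma shock_orbit_backward (f : R -> R) (a s : R) :
  convex_flux f -> 0 < a -> rising_orbit f (f a) (fun t => shock f a (s - t)).
Proof.
  intros H Ha t. split; [|now apply shock_below].
  replace (f a - f (shock f a (s - t))) with (-1 * (f (shock f a (s - t)) - f a))
    by ring.
  apply (is_derive_comp (shock f a) (fun t => s - t)).
  - now apply is_derive_shock.
  - auto_derive; trivial; ring.
Qed.

Lemma shock_orbit_forward (f : R -> R) (a s : R) :
  convex_flux f -> 0 < a ->
  rising_orbit (fun z => f (- z)) (f a) (fun t => - shock f a (s + t)).
Proof.
  intros H Ha t. rewrite Ropp_involutive. split; [|now apply shock_below].
  replace (f a - f (shock f a (s + t))) with (- (1 * (f (shock f a (s + t)) - f a)))
    by ring.
  apply (is_derive_opp (fun t => shock f a (s + t))).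
  apply (is_derive_comp (shock f a) (fun t => s + t)).
  - now apply is_derive_shock.
  - auto_derive; trivial; ring.
Qed.

(** Both profiles take the value [u1] at [x = 1]. Read leftwards in the time [t = (1 - x) / eps]
    they are rising orbits from [u1], and the solution reaches [u0] at time [1 / eps]. *)
Lemma right_layer (f : R -> R) (u0 u1 : R) :
  convex_flux f -> u1 < u0 -> f u1 < f u0 ->
  0 < u0 /\
  exists C, 0 < C /\ forall eps v x,
    0 < eps <= 1 -> is_bvp_solution f eps u0 u1 v -> 0 <= x <= 1 ->
    Rabs (v x - shock f u0 ((x - 1) / eps + phi f u0 u1))
    <= C * exp (- (Derive f u0 / eps)).
Proof.
  intros H Hu Hlt.
  assert (Hu0 : 0 < u0).
  { destruct (Rlt_le_dec 0 u0) as [Hl | Hl]; trivial.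
    pose proof (flux_decreasing f u1 u0 H Hl Hu). lra. }
  split; trivial.
  destruct (one_sided_estimate f u1 u0 H Hu Hlt) as [C [HC HE]].
  exists C. split; trivial. intros eps v x Heps Hv Hx.
  destruct (bvp_is_shock f v eps u0 u1 H Hu ltac:(lra) Hv) as [a [lam [Ha Hlam]]].
  destruct Hv as [_ [_ [Hv0 Hv1]]].
  assert (Hinv : 1 <= / eps).
  { rewrite <- Rinv_1. apply Rinv_le_contravar; lra. }
  assert (H0 : shock f a lam = u0).
  { rewrite <- Hv0, Hlam by lra. f_equal. unfold Rdiv. ring. }
  assert (H1 : shock f a (lam + / eps) = u1).
  { rewrite <- Hv1, Hlam by lra. f_equal. unfold Rdiv. ring. }
  specialize (HE (f a) (fun t => shock f a (lam + / eps - t))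
    (fun t => shock f u0 (phi f u0 u1 - t)) (/ eps) ((1 - x) * / eps)).
  replace (v x) with (shock f a (lam + / eps - (1 - x) * / eps))
    by (rewrite Hlam by lra; f_equal; unfold Rdiv; ring).
  replace ((x - 1) / eps + phi f u0 u1) with (phi f u0 u1 - (1 - x) * / eps)
    by (unfold Rdiv; ring).
  apply HE; trivial.
  - rewrite <- H0. now apply shock_below.
  - apply Rmult_le_pos; lra.
  - now apply shock_orbit_backward.
  - now apply shock_orbit_backward.
  - now rewrite Rminus_0_r.
  - rewrite Rminus_0_r. apply shock_phi; trivial.
    now apply (flux_lt_level f u0 u1 H Hu0).
  - rewrite <- H0. f_equal. ring.
  - intros s. now apply shock_between.
Qed.

(** After reflection both profiles, read rightwards from [x = 0], are rising orbits from [- u0], and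
    the solution reaches [- u1] at time [1 / eps]. The limiting level is [f u1], and a shock is
    labelled by its positive end, here [dagger f u1]. *)
Lemma left_layer (f : R -> R) (u0 u1 : R) :
  convex_flux f -> u1 < u0 -> f u0 < f u1 ->
  u1 < 0 /\
  exists C, 0 < C /\ forall eps v x,
    0 < eps <= 1 -> is_bvp_solution f eps u0 u1 v -> 0 <= x <= 1 ->
    Rabs (v x - shock f (dagger f u1) (x / eps + phi f (dagger f u1) u0))
    <= C * exp (Derive f u1 / eps).
Proof.
  intros H Hu Hlt.
  assert (Hu1 : u1 < 0).
  { destruct (Rlt_le_dec u1 0) as [Hl | Hl]; trivial.
    pose proof (flux_increasing f u1 u0 H Hl Hu). lra. }
  split; trivial.
  destruct (dagger_neg f u1 H Hu1) as [Hd Hfd].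
  assert (Hdd : dagger f (dagger f u1) = u1) by (now apply dagger_unique).
  set (d := dagger f u1) in *.
  destruct (one_sided_estimate _ (- u0) (- u1) (convex_flux_reflect f H))
    as [C [HC HE]]; [lra | now rewrite !Ropp_involutive |].
  rewrite Derive_reflect, !Ropp_involutive in HE by apply (flux_ex f H).
  exists C. split; trivial. intros eps v x Heps Hv Hx.
  destruct (bvp_is_shock f v eps u0 u1 H Hu ltac:(lra) Hv) as [a [lam [Ha Hlam]]].
  destruct Hv as [_ [_ [Hv0 Hv1]]].
  assert (Hinv : 1 <= / eps).
  { rewrite <- Rinv_1. apply Rinv_le_contravar; lra. }
  assert (H0 : shock f a lam = u0).
  { rewrite <- Hv0, Hlam by lra. f_equal. unfold Rdiv. ring. }
  assert (H1 : shock f a (lam + / eps) = u1).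
  { rewrite <- Hv1, Hlam by lra. f_equal. unfold Rdiv. ring. }
  specialize (HE (f a) (fun t => - shock f a (lam + t))
    (fun t => - shock f d (phi f d u0 + t)) (/ eps) (x * / eps)).
  replace (Derive f u1 / eps) with (- (- Derive f u1 * / eps))
    by (unfold Rdiv; ring).
  rewrite Hlam by lra. unfold Rdiv.
  rewrite (Rplus_comm _ lam), (Rplus_comm _ (phi f d u0)).
  replace (shock f a (lam + x * / eps) - shock f d (phi f d u0 + x * / eps))
    with (- (- shock f a (lam + x * / eps) - - shock f d (phi f d u0 + x * / eps)))
    by ring.
  rewrite Rabs_Ropp. apply HE; trivial.
  - rewrite <- H1. now apply shock_below.
  - apply Rmult_le_pos; lra.
  - now apply shock_orbit_forward.
  - rewrite <- Hfd. now apply shock_orbit_forward.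
  - now rewrite Rplus_0_r, H0.
  - rewrite Rplus_0_r, shock_phi; trivial.
    apply (flux_lt_level f d u0 H Hd). now rewrite Hfd.
  - now rewrite H1.
  - intros s. pose proof (shock_between f d (phi f d u0 + s) H Hd). lra.
Qed.

(** * The interior layer *)

(** Converts an error in the position of the layer into an error in its value. *)
Lemma shock_lipschitz (f : R -> R) (a x y : R) :
  convex_flux f -> 0 < a ->
  Rabs (shock f a x - shock f a y) <= f a * Rabs (x - y).
Proof.
  intros H Ha.
  destruct (MVT_gen (shock f a) y x (fun t => f (shock f a t) - f a)) as [c [_ Hc]].
  - intros; now apply is_derive_shock.
  - intros; now apply continuity_pt_filterlim, continuous_shock.
  - rewrite Hc, Rabs_mult. apply Rmult_le_compat_r; [apply Rabs_pos|].
    pose proof (shock_below f a c H Ha). pose proof (flux_nonneg f (shock f a c) H).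
    apply Rabs_le. lra.
Qed.

(** Reflection changes the sign of the derivative, hence of the numerator. This identifies the
    limiting arrival integral of the negative half of the layer with the first integral in
    [shock_shift]. *)
Lemma shift_integrand_reflect (f : R -> R) (u c : R) :
  convex_flux f -> u < 0 -> f 0 < f u ->
  RInt (shift_integrand (fun z => f (- z)) (- u) (f u)) 0 (- u)
  = - RInt (fun z => (Derive f u - Derive f z) / (f u - f z)) u 0.
Proof.
  intros H Hu Hlt.
  set (h := fun z => (Derive f u - Derive f z) / (f u - f z)).
  pose proof (ex_RInt_shift_integrand _ 0 (- u) (convex_flux_reflect f H)) as Hex.
  cbv beta in Hex. rewrite Ropp_0, Ropp_involutive in Hex. specialize (Hex ltac:(lra) Hlt).
  set (k := shift_integrand (fun z => f (- z)) (- u) (f u)) in *.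
  assert (Hk : forall z, k (- z) = - h z).
  { intros z. unfold k, h, shift_integrand.
    rewrite !Derive_reflect, !Ropp_involutive by apply (flux_ex f H).
    unfold Rdiv. ring. }
  rewrite <- Ropp_0 in Hex at 1.
  pose proof (RInt_reflect k 0 u Hex) as Hr. rewrite Ropp_0 in Hr.
  rewrite (RInt_ext _ (fun z => - h z)) in Hr by (intros; apply Hk).
  rewrite Ropp_0 in Hex.
  assert (Hexk : ex_RInt h 0 u).
  { apply (ex_RInt_ext (fun z => - k (- z))).
    - intros z _. rewrite Hk. apply Ropp_involutive.
    - apply (ex_RInt_comp_opp k). now rewrite Ropp_0. }
  pose proof (RInt_opp h 0 u Hexk) as Ho. unfold opp in Ho; simpl in Ho.
  rewrite Ho in Hr.
  pose proof (opp_RInt_swap h 0 u Hexk) as Hs. unfold opp in Hs; simpl in Hs.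
  rewrite Hs in Hr. rewrite Hr. symmetry. apply Ropp_involutive.
Qed.

(* With [T] and [S] the scaled distances from the zero of [v] to the two ends,
   [p T = I + L] and [q S = J + L] for the same [L = ln (c / (c - F))];
   eliminating [L] locates the zero exactly in terms of [I] and [J]. *)
Lemma centered_layer (f : R -> R) (u0 u1 : R) :
  convex_flux f -> u1 < u0 -> f u0 = f u1 ->
  0 < u0 /\ u1 < 0 /\ u1 = dagger f u0 /\
  exists C, 0 < C /\ forall eps v x,
    0 < eps <= 1 -> is_bvp_solution f eps u0 u1 v -> 0 <= x <= 1 ->
    let p := Derive f u0 in
    let q := Derive f (dagger f u0) in
    Rabs (v x - shock f u0 ((x - q / (q - p)) / eps + shock_shift f u0))
    <= C / eps * exp (- (q * p / (q - p) * (1 / eps))).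
Proof.
  intros H Hu He.
  assert (Hu0 : 0 < u0).
  { destruct (Rlt_le_dec 0 u0) as [Hl | Hl]; trivial.
    pose proof (flux_decreasing f u1 u0 H Hl Hu). lra. }
  assert (Hu1 : u1 < 0).
  { destruct (Rlt_le_dec u1 0) as [Hl | Hl]; trivial.
    pose proof (flux_increasing f u1 u0 H Hl Hu). lra. }
  assert (Hdag : dagger f u0 = u1) by (apply dagger_unique; trivial; lra).
  split; [|split; [|split]]; trivial; [now symmetry|].
  unfold shock_shift. rewrite Hdag.
  pose proof (flux_pos f u0 H Hu0) as HF.
  assert (HF0 : f 0 < f u0) by (rewrite (flux_at_0 f H); lra).
  assert (HF1 : f (- 0) < f (- - u1)) by (now rewrite Ropp_0, Ropp_involutive, <- He).
  pose proof (convex_flux_reflect f H) as H'.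
  destruct (orbit_arrival f 0 u0 H Hu0 HF0) as [K1 [HK1 HA1]].
  destruct (orbit_arrival _ 0 (- u1) H' ltac:(lra) HF1) as [K2 [HK2 HA2]].
  destruct (orbit_comparison f 0 u0 H Hu0 HF0) as [M1 [HM1 HB1]].
  destruct (orbit_comparison _ 0 (- u1) H' ltac:(lra) HF1) as [M2 [HM2 HB2]].
  rewrite Derive_reflect, !Ropp_involutive, Ropp_0 in HA2 by apply (flux_ex f H).
  rewrite !Ropp_involutive in HB2. rewrite <- He in HA2, HB2.
  rewrite (flux_at_0 f H) in HA1, HA2.
  pose proof (shift_integrand_reflect f u1 0 H Hu1 ltac:(lra)) as Hrefl.
  rewrite <- He in Hrefl. rewrite Hrefl in HA2.
  set (J0 := RInt (fun z => (Derive f u1 - Derive f z) / (f u0 - f z)) u1 0) in *.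
  change (fun z : R => (Derive f u0 - Derive f z) / (f u0 - f z))
    with (shift_integrand f u0 (f u0)).
  set (I0 := RInt (shift_integrand f u0 (f u0)) 0 u0) in *.
  pose proof (Derive_flux_pos f u0 H Hu0) as Hp.
  assert (Hq : Derive f u1 < 0).
  { rewrite <- (flux_d0 f H). now apply (flux_incr f H). }
  (* Both rates are made positive: the [q] of the statement is [- q] from here on. *)
  set (p := Derive f u0) in *. set (q := - Derive f u1) in *.
  replace (Derive f u1) with (- q) by (unfold q; ring).
  assert (Hq0 : 0 < q) by (unfold q; lra). clearbody q. clear Hq.
  set (D := (f u0 + (u0 - u1)) * exp (K1 + K2)).
  assert (HD : 0 < D) by (apply Rmult_lt_0_compat; [lra | apply exp_pos]).
  assert (HKp : 0 < f u0 * ((K1 + K2) / (p + q))).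
  { apply Rmult_lt_0_compat; trivial. apply Rdiv_lt_0_compat; lra. }
  exists ((M1 + M2 + f u0 * ((K1 + K2) / (p + q))) * D). split.
  { apply Rmult_lt_0_compat; trivial. lra. }
  intros eps v x Heps Hv Hx. cbv zeta.
  destruct (bvp_is_shock f v eps u0 u1 H Hu ltac:(lra) Hv) as [a [lam [Ha Hlam]]].
  destruct Hv as [_ [_ [Hv0 Hv1]]].
  assert (Hinv : 1 <= / eps).
  { rewrite <- Rinv_1. apply Rinv_le_contravar; lra. }
  assert (H0 : shock f a lam = u0).
  { rewrite <- Hv0, Hlam by lra. f_equal. unfold Rdiv. ring. }
  assert (H1 : shock f a (lam + / eps) = u1).
  { rewrite <- Hv1, Hlam by lra. f_equal. unfold Rdiv. ring. }
  pose proof (shock_0 f a H Ha) as Hz.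
  assert (Hc : f u0 < f a) by (rewrite <- H0; now apply shock_below).
  (* The zero of the solution lies inside the interval; the times from it to the ends are
     [T = - lam] and [S = lam + / eps], with sum [/ eps]. *)
  assert (HT : lam < 0) by (apply (shock_lt_reg f a); trivial; lra).
  assert (HS : 0 < lam + / eps) by (apply (shock_lt_reg f a); trivial; lra).
  destruct (HA1 (f a) (fun t => shock f a (0 - t)) (- lam)) as [A1 [A2 [A3 A4]]];
    trivial; [lra | now apply shock_orbit_backward | now rewrite Rminus_0_r | |].
  { rewrite <- H0. f_equal. ring. }
  destruct (HA2 (f a) (fun t => - shock f a (0 + t)) (lam + / eps))
    as [B1 [B2 [B3 B4]]];
    trivial; [lra | now apply shock_orbit_forward | | |].
  { rewrite Rplus_0_r, Hz. ring. }
  { now rewrite Rplus_0_l, H1. }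
  set (I := RInt (shift_integrand f u0 (f a)) 0 u0) in *.
  set (J := RInt (shift_integrand (fun z => f (- z)) (- u1) (f a)) 0 (- u1)) in *.
  set (delta := f a - f u0) in *.
  assert (Hdelta : 0 < delta) by (unfold delta; lra).
  set (E := exp (- (- q * p / (- q - p) * (1 / eps)))).
  assert (HE0 : 0 < E) by apply exp_pos.
  assert (HdE : delta <= D * E).
  { set (L := ln (f a - 0) - ln delta) in *.
    (* Weighting the two arrival formulas by [q] and [p] eliminates [lam]:
       [q p / eps = q I + p J + (p + q) L], where [I <= K1] and [J <= K2]. *)
    assert (HL : q * p / (p + q) * / eps - (K1 + K2) <= L).
    { apply Rmult_le_reg_r with (p + q); [lra|].
      replace ((q * p / (p + q) * / eps - (K1 + K2)) * (p + q))
        with (q * p * / eps - (K1 + K2) * (p + q)) by (field; lra).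
      assert (E1 : p * (- lam) = I + L) by (unfold L; lra).
      assert (E2 : q * (lam + / eps) = J + L) by (unfold L; lra).
      assert (E3 : q * p * / eps = q * I + p * J + L * (p + q)).
      { replace (q * p * / eps) with (q * (p * - lam) + p * (q * (lam + / eps)))
          by ring. rewrite E1, E2. ring. }
      nra. }
    assert (Hd1 : delta = f a * exp (- L)).
    { unfold L. rewrite Rminus_0_r.
      replace (- (ln (f a) - ln delta)) with (ln delta + - ln (f a)) by ring.
      rewrite exp_plus, exp_Ropp, !exp_ln by lra. field. lra. }
    (* The bounds [delta T <= u0] and [delta S <= - u1] add up to [delta / eps <= u0 - u1], and
       [1 <= / eps]. *)
    assert (Hd2 : f a <= f u0 + (u0 - u1)).
    { assert (delta * / eps <= u0 - u1) by nra.
      assert (delta * 1 <= delta * / eps) by (apply Rmult_le_compat_l; lra).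
      unfold delta in *. lra. }
    rewrite Hd1. unfold D, E. rewrite Rmult_assoc, <- exp_plus.
    apply Rmult_le_compat; [lra | left; apply exp_pos | trivial |].
    assert (Hle : - L <= K1 + K2 + - (- q * p / (- q - p) * (1 / eps))).
    { replace (- q * p / (- q - p) * (1 / eps)) with (q * p / (p + q) * / eps)
        by (field; lra). lra. }
    destruct Hle as [Hle | ->]; [left; now apply exp_increasing | lra]. }
  set (s := x * / eps + lam).
  assert (Hs : v x = shock f a s) by (now rewrite Hlam by lra).
  (* Both shocks vanish at phase 0, so they are compared from there: backwards for [s <= 0],
     forwards after reflection for [s > 0]. *)
  assert (Hcmp : Rabs (shock f a s - shock f u0 s) <= (M1 + M2) * delta).
  { assert (Hm1 : 0 < M1 * delta) by (now apply Rmult_lt_0_compat).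
    assert (Hm2 : 0 < M2 * delta) by (now apply Rmult_lt_0_compat).
    destruct (Rle_lt_dec s 0) as [Hs0 | Hs0].
    - specialize (HB1 (f a) (fun t => shock f a (0 - t)) (fun t => shock f u0 (0 - t))
        (- s) Hc (shock_orbit_backward f a 0 H Ha) (shock_orbit_backward f u0 0 H Hu0)).
      cbv beta in HB1. rewrite Rminus_0_r in HB1.
      specialize (HB1 Hz (shock_0 f u0 H Hu0)
        (fun t => proj2 (shock_between f u0 (0 - t) H Hu0)) ltac:(lra)).
      replace (0 - - s) with s in HB1 by ring. fold delta in HB1. lra.
    - specialize (HB2 (f a) (fun t => - shock f a (0 + t)) (fun t => - shock f u0 (0 + t))
        s Hc (shock_orbit_forward f a 0 H Ha) (shock_orbit_forward f u0 0 H Hu0)).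
      cbv beta in HB2. rewrite !Rplus_0_l, Hz, (shock_0 f u0 H Hu0), Ropp_0 in HB2.
      specialize (HB2 eq_refl eq_refl).
      assert (Hb : forall t, - shock f u0 (0 + t) < - u1).
      { intros t. pose proof (shock_between f u0 (0 + t) H Hu0). lra. }
      specialize (HB2 Hb ltac:(lra)). fold delta in HB2.
      replace (shock f a s - shock f u0 s) with (- (- shock f a s - - shock f u0 s))
        by ring. rewrite Rabs_Ropp. lra. }
  set (w := (x - - q / (- q - p)) / eps + 1 / (- q - p) * (J0 + I0)).
  (* Subtracting the arrival formulas eliminates [L] and gives [lam = (J - I - q / eps) / (p + q)].
     The phase [w] has [I0] and [- J0] in place of [I] and [J], with errors at most [K1 delta T] and
     [K2 delta S]. *)
  assert (Hsw : Rabs (s - w) <= (K1 + K2) / (p + q) * (delta * / eps)).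
  { assert (Hlamp : lam = (J - I - q * / eps) / (p + q)).
    { apply Rmult_eq_reg_r with (p + q); [|lra].
      replace ((J - I - q * / eps) / (p + q) * (p + q)) with (J - I - q * / eps)
        by (field; lra). lra. }
    assert (Hdiff : s - w = ((J - - J0) - (I - I0)) * / (p + q)).
    { unfold s, w. rewrite Hlamp. field. lra. }
    rewrite Hdiff, Rabs_mult, (Rabs_pos_eq (/ (p + q)))
      by (left; apply Rinv_0_lt_compat; lra).
    replace ((K1 + K2) / (p + q) * (delta * / eps))
      with ((K1 + K2) * (delta * / eps) * / (p + q)) by (field; lra).
    apply Rmult_le_compat_r; [left; apply Rinv_0_lt_compat; lra|].
    unfold Rminus at 1. apply Rle_trans with (1 := Rabs_triang _ _).
    rewrite Rabs_Ropp.
    assert (K1 * delta * - lam <= K1 * (delta * / eps)).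
    { rewrite Rmult_assoc. apply Rmult_le_compat_l; [lra|].
      apply Rmult_le_compat_l; lra. }
    assert (K2 * delta * (lam + / eps) <= K2 * (delta * / eps)).
    { rewrite Rmult_assoc. apply Rmult_le_compat_l; [lra|].
      apply Rmult_le_compat_l; lra. }
    lra. }
  pose proof (shock_lipschitz f u0 s w H Hu0) as Hlip.
  rewrite Hs.
  replace (shock f a s - shock f u0 w)
    with ((shock f a s - shock f u0 s) + (shock f u0 s - shock f u0 w)) by ring.
  apply Rle_trans with (1 := Rabs_triang _ _).
  apply (Rmult_le_compat_l (f u0)) in Hsw; [|lra].
  assert (Hde : delta <= delta * / eps).
  { rewrite <- (Rmult_1_r delta) at 1. apply Rmult_le_compat_l; lra. }
  assert (Hfin : (M1 + M2) * delta <= (M1 + M2) * (delta * / eps)).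
  { apply Rmult_le_compat_l; lra. }
  apply Rle_trans with
    ((M1 + M2 + f u0 * ((K1 + K2) / (p + q))) * (delta * / eps)); [lra|].
  unfold Rdiv at 2. rewrite !Rmult_assoc.
  apply Rmult_le_compat_l; [lra|].
  rewrite (Rmult_comm (/ eps)), <- Rmult_assoc.
  apply Rmult_le_compat_r; [lra | exact HdE].
Qed.

Theorem theorem3p6 :
  forall (f : R -> R) (u0 u1 : R) (hat_u : R -> R -> R),
    C2 f -> strictly_convex f -> f 0 = 0 -> Derive f 0 = 0 ->
    u1 < u0 ->
    (forall eps : R, 0 < eps -> is_bvp_solution f eps u0 u1 (hat_u eps)) ->
    (forall eps : R, 0 < eps ->
       exists! p : R * R,
         0 < fst p /\
         forall x : R, 0 <= x <= 1 ->
           hat_u eps x = shock f (fst p) (x / eps + snd p))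
    /\
    (f u1 < f u0 ->
       0 < u0 /\
       exists C : R, 0 < C /\
         forall eps x : R, 0 < eps <= 1 -> 0 <= x <= 1 ->
           Rabs (hat_u eps x - shock f u0 ((x - 1) / eps + phi f u0 u1))
           <= C * exp (- (Derive f u0 / eps)))
    /\
    (f u0 < f u1 ->
       u1 < 0 /\
       exists C : R, 0 < C /\
         forall eps x : R, 0 < eps <= 1 -> 0 <= x <= 1 ->
           Rabs (hat_u eps x
                 - shock f (dagger f u1) (x / eps + phi f (dagger f u1) u0))
           <= C * exp (Derive f u1 / eps))
    /\
    (f u0 = f u1 ->
       0 < u0 /\ u1 < 0 /\ u1 = dagger f u0 /\
       exists C : R, 0 < C /\
         forall eps x : R, 0 < eps <= 1 -> 0 <= x <= 1 ->
           let p := Derive f u0 in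
           let q := Derive f (dagger f u0) in
           Rabs (hat_u eps x
                 - shock f u0 ((x - q / (q - p)) / eps + shock_shift f u0))
           <= C / eps * exp (- (q * p / (q - p) * (1 / eps)))).
Proof.
  intros f u0 u1 hat_u H2 Hconv Hf0 Hd0 Hu Hsol.
  pose proof (convex_flux_intro f H2 Hconv Hf0 Hd0) as H.
  split; [|split; [|split]].
  - intros eps Heps.
    destruct (bvp_is_shock f (hat_u eps) eps u0 u1 H Hu Heps (Hsol eps Heps))
      as [a [lam [Ha Hlam]]].
    exists (a, lam). split; [split; trivial|].
    intros [b mu] [Hb Hmu]; simpl in *.
    destruct (shock_representation_unique f a b eps lam mu) as [-> ->]; trivial.
    intros x Hx. now rewrite <- Hlam, <- Hmu.
  - intros Hlt. destruct (right_layer f u0 u1 H Hu Hlt) as [H0 [C [HC HE]]].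
    split; trivial. exists C. split; trivial.
    intros eps x Heps Hx. apply HE; trivial. apply Hsol. lra.
  - intros Hlt. destruct (left_layer f u0 u1 H Hu Hlt) as [H1 [C [HC HE]]].
    split; trivial. exists C. split; trivial.
    intros eps x Heps Hx. apply HE; trivial. apply Hsol. lra.
  - intros He. destruct (centered_layer f u0 u1 H Hu He)
      as [H0 [H1 [Hdag [C [HC HE]]]]].
    split; [|split; [|split]]; trivial. exists C. split; trivial.
    intros eps x Heps Hx. apply HE; trivial. apply Hsol. lra.
Qed.
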